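(* Let $S\subset\mathbb{C}$ be a plane domain with at least two boundary points, and let $[\mu]_Z\in Z(S)$. Then $[\mu]_Z$ contains infinitely many extremal Beltrami differentials that are of non-landslide type and of non-constant modulus, unless $[\mu]_Z$ contains a unique extremal Beltrami differential.
   Context: $Bel(S)$ denotes the Banach space of Beltrami differentials $\mu=\mu(z)\,d\bar z/dz$ on $S$ with finite $L^\infty$-norm $\|\mu\|_\infty$ (for a plane domain: essentially bounded measurable complex functions on $S$, identified when equal a.e.). $Q(S)$ denotes the Banach space of integrable holomorphic quadratic differentials $\varphi$ on $S$ (holomorphic functions on $S$ with $\|\varphi\|=\iint_S|\varphi(z)|\,dx\,dy<\infty$). Two elements $\mu,\nu\in Bel(S)$ are infinitesimally equivalent if $\iint_S(\mu-\nu)\varphi\,dx\,dy=0$ for all $\varphi\in Q(S)$. $Z(S)$ is the quotient of $Bel(S)$ by this equivalence relation, and $[\mu]_Z$ is the class of $\mu$. Its norm is $\|[\mu]_Z\|=\sup\{\mathrm{Re}\iint_S\mu\varphi\,dx\,dy:\varphi\in Q(S),\|\varphi\|=1\}=\inf\{\|\nu\|_\infty:\nu\in[\mu]_Z\}$. An element $\nu\in[\mu]_Z$ is extremal if $\|\nu\|_\infty=\|[\mu]_Z\|$. A Beltrami differential $\nu\in Bel(S)$ is of landslide type if there is a non-empty open set $E\subset S$ with $\operatorname{ess\,sup}_{z\in E}|\nu(z)|<\|\nu\|_\infty$; otherwise it is of non-landslide type. $\nu$ is of constant modulus if $|\nu|$ is a.e. equal to a constant on $S$, and of non-constant modulus otherwise.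 *)

(* Defs.v *)
From HB Require Import structures.
From mathcomp Require Import all_boot all_order all_algebra.
From mathcomp Require Import complex.
From mathcomp Require Import all_classical all_reals all_analysis ess_sup_inf.

Set Implicit Arguments.
Unset Strict Implicit.
Unset Printing Implicit Defensive.

Import Order.TTheory GRing.Theory Num.Theory.
Import numFieldNormedType.Exports.

Local Open Scope classical_set_scope.
Local Open Scope ring_scope.
Local Open Scope complex_scope.

(* [R[i]^o] is R[i] as a normed space over itself: it carries the usual
   topology of the plane, and derivatives in it are complex derivatives. *)
Notation plane R := (R[i]^o).

Section Plane.
Context {R : realType}.
Implicit Types (S E : set (plane R)) (f nu mu phi : plane R -> plane R).

Definition modulus (z : plane R) : R := ComplexField.Normc.normc z.

(* R[i] has no measurable structure in the library: area is Lebesgue measure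
   on R * R (with its Borel sets) and everything is pulled back along [toC]. *)
Definition toC (p : measurableTypeR R * measurableTypeR R) : plane R :=
  p.1 +i* p.2.

Definition area := (@lebesgue_measure R \x @lebesgue_measure R)%E.

Definition ae_on S (P : plane R -> Prop) : Prop :=
  \forall p \ae area, S (toC p) -> P (toC p).

Definition measurable_on S f : Prop :=
  measurable_fun (toC @^-1` S) (@complex.Re R \o f \o toC) /\
  measurable_fun (toC @^-1` S) (@complex.Im R \o f \o toC).

Definition cintegral S f : R[i] :=
  (\int[area]_(p in toC @^-1` S) complex.Re (f (toC p))) +i*
  (\int[area]_(p in toC @^-1` S) complex.Im (f (toC p))).

(* The essential supremum of |nu| over E; as |nu| >= 0, extending it by 0
   outside E does not change it. *)
Definition ess_sup_on E nu : \bar R :=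
  ess_sup area (fun p => ((EFin \o modulus \o nu) \_ E) (toC p)).

Definition plane_domain S : Prop := [/\ open S, connected S & S !=set0].

Definition boundary S : set (plane R) := closure S `\` interior S.

Definition holomorphic_on S f : Prop := forall z, S z -> derivable f z 1.

Definition Q S : set (plane R -> plane R) :=
  [set phi | holomorphic_on S phi /\
    (\int[area]_(p in toC @^-1` S) (modulus (phi (toC p)))%:E < +oo)%E].

(* Bel S consists of representatives, whose values outside S are irrelevant;
   an element of the Banach space Bel(S) is an [ae_class]. The a.e. classes are
   the same for Borel and for Lebesgue measurable representatives. *)
Definition Bel S : set (plane R -> plane R) :=
  [set nu | measurable_on S nu /\ (ess_sup_on S nu < +oo)%E].

Definition ae_class S nu : set (plane R -> plane R) :=
  [set nu' | Bel S nu' /\ ae_on S (fun z => nu' z = nu z)].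

Definition inf_equivalent S mu nu : Prop :=
  forall phi, Q S phi -> cintegral S (fun z => (mu z - nu z) * phi z) = 0.

Definition Zclass S mu : set (plane R -> plane R) :=
  [set nu | Bel S nu /\ inf_equivalent S mu nu].

(* The norm of [mu]_Z, as the quotient norm. The dual formula, a supremum over
   the unit sphere of Q(S), would be a supremum over the empty set when
   Q(S) = 0, as for the plane punctured twice. *)
Definition Znorm S mu : \bar R := ereal_inf (ess_sup_on S @` Zclass S mu).

Definition extremal S mu : set (plane R -> plane R) :=
  [set nu | Zclass S mu nu /\ ess_sup_on S nu = Znorm S mu].

Definition landslide S nu : Prop :=
  exists E : set (plane R),
    [/\ open E, E !=set0, E `<=` S & (ess_sup_on E nu < ess_sup_on S nu)%E].

Definition constant_modulus S nu : Prop :=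
  exists c : R, ae_on S (fun z => modulus (nu z) = c).

End Plane.

(* Main.v *)
Require Import Defs.
From mathcomp Require Import all_boot all_order all_algebra.
From mathcomp Require Import complex.
From mathcomp Require Import all_classical all_reals all_analysis ess_sup_inf measurable_realfun.
From mathcomp Require Import ring lra.

(** Let [k] be the norm of the class of [mu].

    The norm is attained ([exists_extremal]). Hence, if there is not exactly one
    extremal element, there are two, and two cases arise.

    If no extremal element is of landslide type, the proper convex combinations
    of two extremal elements do ([infinite_of_two]): they are extremal, and they
    are not of constant modulus because the disc is strictly convex.

    If some extremal [nu] is of landslide type, then [|nu| <= c < k] on an open
    set [E], and [nu] is modified ([infinite_of_landslide]) by adding multiples
    of functions [eta] that are orthogonal to all holomorphic functions
    ([exists_annihilator]). Such a function is [2 dbar (f (x) g (y))], where [f]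
    and [g] are bumps whose derivatives are supported in Cantor sets of positive
    measure. Its support has positive area and lies in a prescribed rectangle,
    but has no interior, so that disjoint supports can be found in all the
    rectangles of a countable base of the topology ([disjoint_annihilators]). On
    each support one adds the largest multiple of [eta] that keeps the modulus
    at most [k] ([sharp_coefficient]). As the supports are disjoint the sum of
    all these modifications is extremal ([superposition]), and its modulus comes
    arbitrarily close to [k] in every open set. One further support inside [E]
    is kept for a small multiple of [eta]: there the modulus stays below [k], so
    that it is not constant, and varying the multiple gives infinitely many
    elements.

    Orthogonality is not obvious, since a holomorphic function is only assumed
    to be differentiable, without any regularity of its derivative. It follows
    from Goursat's theorem for rectangles ([goursat]), proved by bisection, by
    averaging over rectangles with a common corner ([weak_cauchy_riemann]).

    The norm is attained because a suitable minimising sequence converges almost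
    everywhere: among elements whose sup norm is close to [k], those of nearly
    minimal weighted [L^2] norm are close to each other, by the parallelogram
    law. *)

Set Implicit Arguments.
Unset Strict Implicit.
Unset Printing Implicit Defensive.

Import Order.TTheory GRing.Theory Num.Theory.
Import numFieldNormedType.Exports.

Local Open Scope classical_set_scope.
Local Open Scope ring_scope.
Local Open Scope complex_scope.

Local Notation Re := (@complex.Re _).
Local Notation Im := (@complex.Im _).

(** * Modulus, rectangles and measurability in the plane *)

Section Modulus.
Context {R : realType}.
Implicit Types z w : plane R.

Lemma normE z : `|z| = (modulus z)%:C.
Proof. by case: z => x y; rewrite normc_def. Qed.

Lemma modulus_ge0 z : 0 <= modulus z.
Proof. by rewrite -ler0c -normE normr_ge0. Qed.

Lemma modulusD z w : modulus (z + w) <= modulus z + modulus w.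
Proof. exact: le_normcD. Qed.

Lemma modulusM z w : modulus (z * w) = modulus z * modulus w.
Proof. exact: ComplexField.Normc.normcM. Qed.

Lemma modulusN z : modulus (- z) = modulus z.
Proof. exact: normcN. Qed.

Lemma modulus_real (x : R) : modulus x%:C = `|x|.
Proof. by rewrite /modulus/= expr0n/= addr0 sqrtr_sqr. Qed.

Lemma modulusZ (x : R) z : modulus (x%:C * z) = `|x| * modulus z.
Proof. by rewrite modulusM modulus_real. Qed.

Lemma modulus_eq0 z : modulus z = 0 -> z = 0.
Proof. exact: ComplexField.Normc.eq0_normc. Qed.

Lemma sqr_modulus z : modulus z ^+ 2 = Re z ^+ 2 + Im z ^+ 2.
Proof. by case: z => x y /=; rewrite /modulus/= sqr_sqrtr// addr_ge0// sqr_ge0. Qed.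

Lemma Re_le_modulus z : `|Re z| <= modulus z.
Proof. by rewrite -lecR -normE; exact: normc_ge_Re. Qed.

Lemma Im_le_modulus z : `|Im z| <= modulus z.
Proof.
by case: z => x y; rewrite /modulus/= -sqrtr_sqr ler_wsqrtr// lerDr sqr_ge0.
Qed.

Lemma modulus_le_ReIm z : modulus z <= `|Re z| + `|Im z|.
Proof.
rewrite -(@ler_pXn2r _ 2%N)// ?nnegrE ?modulus_ge0 ?addr_ge0// sqr_modulus.
by rewrite sqrrD !real_normK ?num_real// lerD2r lerDl mulrn_wge0// mulr_ge0.
Qed.

Lemma toC_ReIm z : toC (Re z, Im z) = z.
Proof. by case: z. Qed.

End Modulus.

Section Rectangles.
Context {R : realType}.
Local Notation T := (measurableTypeR R * measurableTypeR R)%type.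
Implicit Types (S U : set (plane R)).

Definition rect (a b c d : R) : set T := [set p | a <= p.1 <= b /\ c <= p.2 <= d].

Lemma rectE a b c d : rect a b c d = `[a, b] `*` `[c, d].
Proof. by apply/seteqP; split => -[x y] /=; rewrite !in_itv. Qed.

Lemma measurable_rect a b c d : measurable (rect a b c d).
Proof. by rewrite rectE; apply: measurableX; exact: measurable_itv. Qed.

(** Openness in terms of squares instead of discs, which suits rectangles. *)
Definition box_open (A : set T) := forall p, A p -> exists2 e : R, 0 < e &
  forall q : T, `|q.1 - p.1| < e -> `|q.2 - p.2| < e -> A q.

Lemma open_box U : open U -> box_open (toC @^-1` U).
Proof.
rewrite openE => oU p /oU /nbhs_ballP[r /= r0 rU].
have /complex_realP[s sE] := gtr0_real r0.
move: r0 rU; rewrite sE ltcR => s0 rU.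
exists (s / 2); first by rewrite divr_gt0.
move=> q q1 q2; apply: rU; rewrite -ball_normE/=.
rewrite normE ltcR (le_lt_trans (modulus_le_ReIm _))//=.
rewrite (distrC p.1) (distrC p.2).
by rewrite [ltRHS](splitr s) ltrD.
Qed.

Definition qrect (q : (rat * rat) * (rat * rat)) : set T :=
  rect (ratr q.1.1) (ratr q.1.2) (ratr q.2.1) (ratr q.2.2).

Definition proper_qrect (q : (rat * rat) * (rat * rat)) :=
  (q.1.1 < q.1.2)%O && (q.2.1 < q.2.2)%O.

Lemma rat_itv_around (x e : R) : 0 < e ->
  exists q : rat * rat, (q.1 < q.2)%O /\
   [/\ x - e < ratr q.1, ratr q.1 < x, x < ratr q.2 & ratr q.2 < x + e].
Proof.
move=> e0.
have /rat_in_itvoo[q1 /[!in_itv]/= /andP[q11 q12]] : x - e < x by rewrite gtrBl.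
have /rat_in_itvoo[q2 /[!in_itv]/= /andP[q21 q22]] : x < x + e by rewrite ltrDl.
exists (q1, q2) => /=; split => //.
by rewrite -(ltr_rat R) (lt_trans q12).
Qed.

(** The rectangles with rational corners are a countable net for the topology:
    open sets are countable unions of them, hence measurable. *)
Lemma box_open_qrect A (p : T) : box_open A -> A p ->
  exists q, [/\ proper_qrect q, qrect q p & qrect q `<=` A].
Proof.
move=> oA /oA[e e0 eA].
have [q [q12 [q1 q2 q3 q4]]] := rat_itv_around p.1 e0.
have [r [r12 [r1 r2 r3 r4]]] := rat_itv_around p.2 e0.
exists (q, r); split; first by rewrite /proper_qrect q12 r12.
  by split; rewrite !ltW.
move=> [x y] [] /= /andP[x1 x2] /andP[y1 y2].
apply: eA => /=; rewrite ltr_norml; apply/andP; split.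
- by rewrite ltrBrDl (lt_le_trans q1).
- by rewrite ltrBlDl (le_lt_trans x2).
- by rewrite ltrBrDl (lt_le_trans r1).
- by rewrite ltrBlDl (le_lt_trans y2).
Qed.

Lemma box_open_measurable A : box_open A -> measurable A.
Proof.
move=> oA.
pose F q := if `[< qrect q `<=` A >] then qrect q else set0.
suff -> : A = \bigcup_q F q.
  apply: countable_bigcupT_measurable => // q; rewrite /F.
  by case: ifP => _ //; exact: measurable_rect.
apply/seteqP; split => [p Ap|p [q _]]; last first.
  by rewrite /F; case: asboolP => // + qp; exact.
have [q [_ qp qA]] := box_open_qrect oA Ap; exists q => //.
by rewrite /F; case: asboolP.
Qed.

Lemma open_measurable U : open U -> measurable (toC @^-1` U : set T).
Proof. by move=> /open_box/box_open_measurable. Qed.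

(** Continuity relative to [D], with squares instead of discs. *)
Definition cont_within (D : set T) (f : T -> R) (p : T) :=
  forall e : R, 0 < e -> exists2 r : R, 0 < r & forall q : T, D q ->
    `|q.1 - p.1| < r -> `|q.2 - p.2| < r -> `|f q - f p| < e.

Definition cont_at := cont_within setT.

Lemma cont_at_within D f p : cont_at f p -> cont_within D f p.
Proof. by move=> cf e /cf[r r0 rf]; exists r => // q _; exact: rf. Qed.

Lemma cont_within_measurable D (f : T -> R) : measurable D ->
  (forall p, D p -> cont_within D f p) -> measurable_fun D f.
Proof.
move=> mD fD; apply: (measurability _ (RGenOInfty.measurableE R)) => //.
move=> _ [_ [x ->] <-].
pose O := [set q : T | exists p (r : R), [/\ `|q.1 - p.1| < r, `|q.2 - p.2| < r &
  forall q' : T, D q' -> `|q'.1 - p.1| < r -> `|q'.2 - p.2| < r -> x < f q']].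
rewrite (_ : _ `&` _ = D `&` O).
  apply: measurableI => //; apply: box_open_measurable => q [p [r [q1 q2 pr]]].
  exists (Num.min (r - `|q.1 - p.1|) (r - `|q.2 - p.2|)).
    by rewrite lt_min !subr_gt0 q1.
  move=> q'; rewrite !lt_min !ltrBrDr => /andP[q'1 _] /andP[_ q'2]; exists p, r.
  have tri (s t k : R) : `|s - k| <= `|s - t| + `|t - k|.
    by rewrite (le_trans _ (ler_normD _ _))// addrA subrK.
  split => //; first exact: le_lt_trans (tri _ q.1 _) q'1.
  exact: le_lt_trans (tri _ q.2 _) q'2.
apply/seteqP; split => p [Dp]; last first.
  by move=> [q [r [p1 p2 qr]]]; split => //=; rewrite in_itv/= andbT qr.
rewrite /= in_itv/= andbT => xf; split => //.
have [r r0 rf] : exists2 r : R, 0 < r & forall q : T, D q -> `|q.1 - p.1| < r ->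
    `|q.2 - p.2| < r -> `|f q - f p| < f p - x.
  by apply: fD => //; rewrite subr_gt0.
exists p, r; rewrite !subrr normr0; split => // q Dq q1 q2.
have := rf q Dq q1 q2; rewrite ltr_norml => /andP[+ _].
by rewrite opprB ltrBrDr subrK.
Qed.

Lemma cont_within_rect_bounded a b c d (f : T -> R) :
  (forall p, rect a b c d p -> cont_within (rect a b c d) f p) ->
  exists M, forall p, rect a b c d p -> `|f p| <= M.
Proof.
move=> cf.
have cK : compact (`[a, b]%classic `*` `[c, d]%classic : set (R * R)).
  by apply: compact_setX; exact: segment_compact.
have : compact [set (f p : R^o) | p in
    (`[a, b]%classic `*` `[c, d]%classic : set (R * R))].
  apply: continuous_compact cK; apply/subspace_continuousP => p pK'.
  have pK : rect a b c d p by rewrite rectE.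
  apply/cvgrPdist_lt => e /(cf p pK)[r r0 rf].
  apply/nbhs_ballP; exists r => // q [q1 q2] qK'.
  have qK : rect a b c d q by rewrite rectE.
  by rewrite distrC; apply: rf => //; rewrite distrC.
move/compact_bounded => [M [_ /(_ (M + 1))]]; rewrite ltrDl ltr01 => /(_ isT) fM.
exists (M + 1) => p; rewrite rectE => pK; apply: fM; exists p => //.
Qed.

End Rectangles.

(** * Goursat's theorem for rectangles *)

Section Bisection.
Context {R : realType}.
Local Notation T := (measurableTypeR R * measurableTypeR R)%type.
Implicit Types a b c d : R.

Definition subrect a0 b0 c0 d0 a b c d :=
  [/\ a0 <= a, a <= b, b <= b0 & [/\ c0 <= c, c <= d & d <= d0]].

Lemma nested_limit (x : nat -> R) (w : R) : 0 <= w ->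
  (forall n, x n <= x n.+1 /\ x n.+1 + w * 2^-1 ^+ n.+1 <= x n + w * 2^-1 ^+ n) ->
  exists l, forall n, x n <= l <= x n + w * 2^-1 ^+ n.
Proof.
move=> w0 xn.
have w2 n : 0 <= w * 2^-1 ^+ n by rewrite mulr_ge0// exprn_ge0.
have x_nd n m : x n <= x (m + n)%N.
  by elim: m => [//|m /le_trans]; apply; rewrite addSn; case: (xn (m + n)%N).
have x_ni n m : x (m + n)%N + w * 2^-1 ^+ (m + n) <= x n + w * 2^-1 ^+ n.
  by elim: m => [//|m]; apply: le_trans; rewrite addSn; case: (xn (m + n)%N).
have xle n m : x m <= x n + w * 2^-1 ^+ n.
  apply: (le_trans (x_nd m n)).
  apply: le_trans (x_ni n m); rewrite addnC lerDl//.
have xsup : has_sup (range x).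
  split; first by exists (x 0%N), 0%N.
  by exists (x 0%N + w * 2^-1 ^+ 0) => _ [n _ <-]; exact: xle.
exists (sup (range x)) => n; apply/andP; split.
  by apply: ub_le_sup; [case: xsup | exists n].
by apply: ge_sup; [case: xsup | move=> _ [m _ <-]; exact: xle].
Qed.

(** Goursat's bisection. If [J] did not vanish on the whole rectangle, one of
    the four quarters would carry at least a quarter of its value, and so on;
    these nested rectangles shrink to a point, near which [J] is of smaller
    order than the square of the perimeter. *)
Lemma bisection (J : R -> R -> R -> R -> R) a0 b0 c0 d0 :
  a0 <= b0 -> c0 <= d0 ->
  (forall a b c d, subrect a0 b0 c0 d0 a b c d ->
    let m := a + (b - a) / 2 in let n := c + (d - c) / 2 in
    J a b c d = J a m c n + J m b c n + (J a m n d + J m b n d)) ->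
  (forall p : T, rect a0 b0 c0 d0 p -> forall e, 0 < e -> exists2 r, 0 < r &
    forall a b c d, subrect a0 b0 c0 d0 a b c d -> rect a b c d p ->
      b - a < r -> d - c < r -> `|J a b c d| <= e * ((b - a) + (d - c)) ^+ 2) ->
  J a0 b0 c0 d0 = 0.
Proof.
move=> ab0 cd0 Jadd Jsmall; apply: contrapT => /eqP J0.
pose w := b0 - a0; pose h := d0 - c0.
have w0 : 0 <= w by rewrite subr_ge0.
have h0 : 0 <= h by rewrite subr_ge0.
have t0 n : 0 < (2^-1 : R) ^+ n by rewrite exprn_gt0.
(* the rectangle of generation [n] is given by its lower left corner *)
pose P n (p : R * R) :=
  subrect a0 b0 c0 d0 p.1 (p.1 + w * 2^-1 ^+ n) p.2 (p.2 + h * 2^-1 ^+ n) /\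
  `|J a0 b0 c0 d0| * (2^-1 ^+ n) ^+ 2 <=
  `|J p.1 (p.1 + w * 2^-1 ^+ n) p.2 (p.2 + h * 2^-1 ^+ n)|.
pose nxt n (p q : R * R) := [/\ p.1 <= q.1,
  q.1 + w * 2^-1 ^+ n.+1 <= p.1 + w * 2^-1 ^+ n, p.2 <= q.2 &
  q.2 + h * 2^-1 ^+ n.+1 <= p.2 + h * 2^-1 ^+ n].
have step (np : nat * (R * R)) :
    exists q, P np.1 np.2 -> P np.1.+1 q /\ nxt np.1 np.2 q.
  case: np => n [a c] /=; have [|nP] := pselect (P n (a, c)); last by exists (0, 0).
  move=> [] /= [h1 h2 h3 [h4 h5 h6]].
  have := Jadd a (a + w * 2^-1 ^+ n) c (c + h * 2^-1 ^+ n) _.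
  move/(_ (And4 h1 h2 h3 (And3 h4 h5 h6))) => /=.
  pose wn := w * 2^-1 ^+ n.+1; pose hn := h * 2^-1 ^+ n.+1.
  have wE : w * 2^-1 ^+ n = wn + wn.
    by rewrite /wn exprS; field.
  have hE : h * 2^-1 ^+ n = hn + hn.
    by rewrite /hn exprS; field.
  have wn0 : 0 <= wn by rewrite mulr_ge0// ltW.
  have hn0 : 0 <= hn by rewrite mulr_ge0// ltW.
  rewrite /P /nxt /subrect /= -/wn -/hn wE hE in h1 h2 h3 h4 h5 h6 *.
  have -> : (a + (wn + wn) - a) / 2 = wn by field.
  have -> : (c + (hn + hn) - c) / 2 = hn by field.
  rewrite !addrA => JE JP.
  set j1 := J a (a + wn) c (c + hn) in JE.
  set j2 := J (a + wn) (a + wn + wn) c (c + hn) in JE.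
  set j3 := J a (a + wn) (c + hn) (c + hn + hn) in JE.
  set j4 := J (a + wn) (a + wn + wn) (c + hn) (c + hn + hn) in JE.
  set t := 2^-1 ^+ n in JP.
  set j0 := `|J a0 b0 c0 d0| in JP *.
  have tE : 2^-1 ^+ n.+1 = t / 2 by rewrite exprS mulrC.
  rewrite !addrA in h3 h6.
  have JE4 : j0 * t ^+ 2 <= `|j1| + `|j2| + `|j3| + `|j4|.
    by rewrite (le_trans JP)// JE (le_trans (ler_normD _ _))// lerD2r
      (le_trans (ler_normD _ _))// lerD2r ler_normD.
  have j4E x : j0 * t ^+ 2 <= x * 4 -> j0 * (t / 2) ^+ 2 <= x.
    move=> ?; rewrite exprMn mulrA exprVn -natrX.
    by rewrite ler_pdivrMr.
  have : [\/ j0 * t ^+ 2 <= `|j1| * 4, j0 * t ^+ 2 <= `|j2| * 4,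
     j0 * t ^+ 2 <= `|j3| * 4 | j0 * t ^+ 2 <= `|j4| * 4].
    have [|?] := leP (j0 * t ^+ 2) (`|j1| * 4); first by constructor.
    have [|?] := leP (j0 * t ^+ 2) (`|j2| * 4); first by constructor.
    have [|?] := leP (j0 * t ^+ 2) (`|j3| * 4); first by constructor.
    have [|?] := leP (j0 * t ^+ 2) (`|j4| * 4); first by constructor.
    by exfalso; lra.
  rewrite tE; case=> /j4E jP.
  - exists (a, c) => _ /=; do !split => //;
      clear - h1 h2 h3 h4 h5 h6 wn0 hn0; lra.
  - exists (a + wn, c) => _ /=; do !split => //;
      clear - h1 h2 h3 h4 h5 h6 wn0 hn0; lra.
  - exists (a, c + hn) => _ /=; do !split => //;
      clear - h1 h2 h3 h4 h5 h6 wn0 hn0; lra.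
  - exists (a + wn, c + hn) => _ /=; do !split => //;
      clear - h1 h2 h3 h4 h5 h6 wn0 hn0; lra.
have [g gP] := choice step.
pose s := fix s n := if n is m.+1 then g (m, s m) else (a0, c0).
have sP n : P n (s n).
  elim: n => [|n ih]; last by case: (gP (n, s n) ih).
  split => /=; last by rewrite expr0 expr1n !mulr1 /w /h !subrKC.
  by rewrite /subrect expr0 !mulr1 /w /h !subrKC; do !split.
have sN n : nxt n (s n) (s n.+1) by case: (gP (n, s n) (sP n)).
have [x xP] : exists x, forall n, (s n).1 <= x <= (s n).1 + w * 2^-1 ^+ n.
  by apply: nested_limit => // n; case: (sN n).
have [y yP] : exists y, forall n, (s n).2 <= y <= (s n).2 + h * 2^-1 ^+ n.
  by apply: nested_limit => // n; case: (sN n).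
have R0xy : rect a0 b0 c0 d0 (x, y).
  by have := xP 0%N; have := yP 0%N; rewrite /= expr0 !mulr1 /w /h !subrKC.
pose e := `|J a0 b0 c0 d0| / (2 * (1 + (w + h) ^+ 2)).
have den0 : 0 < 1 + (w + h) ^+ 2 by rewrite ltr_wpDr// sqr_ge0.
have e0 : 0 < e by rewrite divr_gt0 ?normr_gt0// mulr_gt0.
have [r r0 rJ] := Jsmall _ R0xy e e0.
have [n nr] : exists n, (w + h) * 2^-1 ^+ n < r.
  have /cvgrPdist_lt/(_ r r0)[n _ /(_ n (leqnn n))] :
      (fun n => (w + h) * 2^-1 ^+ n) @ \oo --> (0 : R).
    rewrite -[X in _ --> X](mulr0 (w + h)); apply: cvgMr => //.
    by apply: cvg_expr; rewrite ger0_norm// invf_lt1// ltr1n.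
  rewrite /= sub0r normrN ger0_norm; last exact: mulr_ge0 (addr_ge0 w0 h0) (ltW (t0 n)).
  by exists n.
have [sub Jn] := sP n.
have := rJ _ _ _ _ sub; rewrite /rect/= xP yP => /(_ (conj isT isT)).
rewrite !(addrC (s n).1, addrC (s n).2) !addrK.
have wt : w * 2^-1 ^+ n < r.
  by rewrite (le_lt_trans _ nr)// ler_wpM2r ?lerDl// (ltW (t0 n)).
have ht : h * 2^-1 ^+ n < r.
  by rewrite (le_lt_trans _ nr)// ler_wpM2r ?lerDr// (ltW (t0 n)).
move=> /(_ wt ht).
rewrite -mulrDl exprMn => Jn'.
have : `|J a0 b0 c0 d0| * (2^-1 ^+ n) ^+ 2 <= e * (w + h) ^+ 2 * (2^-1 ^+ n) ^+ 2.
  rewrite (le_trans Jn)//; move: Jn'.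
  by rewrite mulrA !(addrC (s n).1, addrC (s n).2).
rewrite ler_pM2r ?exprn_gt0//.
have -> : `|J a0 b0 c0 d0| = e * (2 * (1 + (w + h) ^+ 2)).
  by rewrite /e mulfVK// gt_eqF// mulr_gt0.
rewrite ler_pM2l//; have := sqr_ge0 (w + h); lra.
Qed.

End Bisection.

Section Goursat.
Context {R : realType}.
Local Notation T := (measurableTypeR R * measurableTypeR R)%type.
Local Notation leb := (@lebesgue_measure R).
Implicit Types (a b c d : R) (A B : T -> R).

(** Differentiability of [A] and [B] at [p] with [dB/dx = - dA/dy]. A
    holomorphic function satisfies it in two ways, for its real and imaginary
    parts [(P, Q)] and for [(- Q, P)], which are the two Cauchy-Riemann
    equations. *)
Definition cr_at A B (p : T) := exists k l m : R, forall e, 0 < e ->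
  exists2 r, 0 < r & forall q : T, `|q.1 - p.1| < r -> `|q.2 - p.2| < r ->
   `|A q - A p - (k * (q.1 - p.1) + l * (q.2 - p.2))| <=
     e * (`|q.1 - p.1| + `|q.2 - p.2|) /\
   `|B q - B p - (m * (q.2 - p.2) - l * (q.1 - p.1))| <=
     e * (`|q.1 - p.1| + `|q.2 - p.2|).

Lemma linear_approx_cont (f : T -> R) (p : T) k l r : 0 < r ->
  (forall q : T, `|q.1 - p.1| < r -> `|q.2 - p.2| < r ->
   `|f q - f p - (k * (q.1 - p.1) + l * (q.2 - p.2))| <= `|q.1 - p.1| + `|q.2 - p.2|) ->
  cont_at f p.
Proof.
move=> r0 fr e e0; pose M := 2 + `|k| + `|l|.
have M0 : 0 < M by rewrite ltr_wpDr// ltr_wpDr.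
exists (Num.min r (e / M)); first by rewrite lt_min r0 divr_gt0.
move=> q _; rewrite !lt_min => /andP[q1 q1'] /andP[q2 q2'].
move: q1' q2' (fr q q1 q2); rewrite !ltr_pdivlMr//.
set x := q.1 - p.1; set y := q.2 - p.2 => xe ye fxy.
have : `|f q - f p| <= `|x| + `|y| + (`|k| * `|x| + `|l| * `|y|).
  rewrite -lerBlDr (le_trans _ fxy)// (le_trans _ (lerB_dist _ _))//.
  by rewrite lerB// (le_trans (ler_normD _ _))// !normrM.
move/le_lt_trans; apply.
have [xy|/ltW xy] := leP `|x| `|y|.
  apply: le_lt_trans ye.
  have := ler_wpM2l (normr_ge0 k) xy; rewrite /M; lra.
apply: le_lt_trans xe.
have := ler_wpM2l (normr_ge0 l) xy; rewrite /M; lra.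
Qed.

Lemma cr_at_cont A B p : cr_at A B p -> cont_at A p /\ cont_at B p.
Proof.
move=> [k [l [m /(_ 1 ltr01)[r r0 rAB]]]]; split.
  apply: (linear_approx_cont (k := k) (l := l) r0) => q q1 q2.
  by case: (rAB q q1 q2); rewrite mul1r.
apply: (linear_approx_cont (k := - l) (l := m) r0) => q q1 q2.
case: (rAB q q1 q2) => _.
by rewrite mul1r (addrC (m * _)) mulNr.
Qed.

Lemma cont_at_hsection (f : T -> R) (x y : R) :
  cont_at f (x, y) -> {for x, continuous (fun x => f (x, y))}.
Proof.
move=> cf; apply/cvgrPdist_lt => e /cf[r r0 rf].
near=> z; rewrite distrC; apply: rf; [by []| |by rewrite /= subrr normr0].
by rewrite /= distrC; near: z; apply/nbhs_ballP; exists r.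
Unshelve. all: by end_near. Qed.

Lemma cont_at_vsection (f : T -> R) (x y : R) :
  cont_at f (x, y) -> {for y, continuous (fun y => f (x, y))}.
Proof.
move=> cf; apply/cvgrPdist_lt => e /cf[r r0 rf].
near=> z; rewrite distrC; apply: rf; [by []|by rewrite /= subrr normr0|].
by rewrite /= distrC; near: z; apply/nbhs_ballP; exists r.
Unshelve. all: by end_near. Qed.

Lemma continuous_itv_integrable (f : R -> R) a b :
  (forall x, a <= x <= b -> {for x, continuous f}) ->
  leb.-integrable `[a, b] (EFin \o f).
Proof.
move=> cf; apply: continuous_compact_integrable; first exact: segment_compact.
by apply: continuous_in_subspaceT => x; rewrite inE/= in_itv/=; exact: cf.
Qed.

Lemma Rintegral_itv_split (f : R -> R) a m b : a <= m -> m <= b ->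
  leb.-integrable `[a, b] (EFin \o f) ->
  \int[leb]_(x in `[a, b]) f x =
  \int[leb]_(x in `[a, m]) f x + \int[leb]_(x in `[m, b]) f x.
Proof.
move=> am mb fi; rewrite -(@Rintegral_itv_obnd_cbnd _ m); last first.
  apply: integrableS fi => // x /=; rewrite !in_itv/= => /andP[mx ->].
  by rewrite (le_trans am (ltW mx)).
by rewrite -(Rintegral_itvB fi) ?bnd_simp// subrKC.
Qed.

Lemma Rintegral_itv_approx (f : R -> R) a b k e : a <= b -> 0 <= e ->
  leb.-integrable `[a, b] (EFin \o f) -> (forall x, a <= x <= b -> `|f x - k| <= e) ->
  `|\int[leb]_(x in `[a, b]) f x - k * (b - a)| <= e * (b - a).
Proof.
move=> ab e0 fi fk.
have cst_int (r : R) : leb.-integrable `[a, b] (EFin \o cst r).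
  by apply: continuous_itv_integrable => x _; exact: cst_continuous.
have cstE (r : R) : \int[leb]_(x in `[a, b]) r = r * (b - a).
  rewrite Rintegral_cst//; congr (_ * _).
  transitivity (fine (lebesgue_measure (`[a, b]%classic : set R))) => //.
  by rewrite lebesgue_measure_itv/= lte_fin; case: ltgtP ab => // ->; rewrite subrr.
rewrite -!cstE -RintegralB//; last exact: cst_int.
have fki : leb.-integrable `[a, b] (EFin \o (fun x => f x - k)).
  by rewrite (_ : EFin \o _ = ((EFin \o f) \- (EFin \o cst k))%E)//; exact: integrableB.
rewrite (le_trans (le_normr_Rintegral _ _))//.
apply: le_Rintegral => //.
  exact: (integrable_norm fki).
exact: cst_int.
Qed.

(** Goursat's theorem for one of the two real parts of the contour integral
    of a holomorphic function around a rectangle: on a small rectangle the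
    affine part of the differential contributes nothing, by the
    Cauchy-Riemann equation, and the remainder is negligible. *)
Lemma goursat A B a b c d : a <= b -> c <= d ->
  (forall p, rect a b c d p -> cr_at A B p) ->
  \int[leb]_(x in `[a, b]) A (x, c) - \int[leb]_(x in `[a, b]) A (x, d) =
  \int[leb]_(y in `[c, d]) B (b, y) - \int[leb]_(y in `[c, d]) B (a, y).
Proof.
move=> ab cd cr.
pose J a b c d :=
  \int[leb]_(x in `[a, b]) A (x, c) - \int[leb]_(x in `[a, b]) A (x, d) -
  (\int[leb]_(y in `[c, d]) B (b, y) - \int[leb]_(y in `[c, d]) B (a, y)).
apply/eqP; rewrite -subr_eq0; apply/eqP; rewrite -/(J a b c d).
have Ai a' b' y : a <= a' -> b' <= b -> c <= y <= d ->
    leb.-integrable `[a', b'] (EFin \o (fun x => A (x, y))).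
  move=> aa bb cyd; apply: continuous_itv_integrable => x /andP[x1 x2].
  apply: cont_at_hsection; apply: (cr_at_cont (cr _ _)).1.
  by split => //=; rewrite (le_trans aa)//= (le_trans x2).
have Bi c' d' x : c <= c' -> d' <= d -> a <= x <= b ->
    leb.-integrable `[c', d'] (EFin \o (fun y => B (x, y))).
  move=> aa bb cyd; apply: continuous_itv_integrable => y /andP[x1 x2].
  apply: cont_at_vsection; apply: (cr_at_cont (cr _ _)).2.
  by split => //=; rewrite (le_trans aa)//= (le_trans x2).
have corners a' b' c' d' : subrect a b c d a' b' c' d' ->
    [/\ a <= a' <= b, a <= b' <= b, c <= c' <= d & c <= d' <= d].
  move=> [aa ab' bb [cc cd' dd]]; split; apply/andP; split => //;
    by [exact: le_trans bb|exact: le_trans aa _|exact: le_trans dd|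
        exact: le_trans cc _].
apply: (@bisection R J a b c d) => //.
  move=> a' b' c' d' sub m n.
  have [xa xb yc yd] := corners _ _ _ _ sub.
  have [aa ab' bb [cc cd' dd]] := sub.
  have [am mb] : a' <= m /\ m <= b' by clear - ab'; rewrite /m; split; lra.
  have [cn nd] : c' <= n /\ n <= d' by clear - cd'; rewrite /n; split; lra.
  rewrite /J.
  rewrite !(Rintegral_itv_split am mb (Ai _ _ _ _ _ _))//.
  rewrite !(Rintegral_itv_split cn nd (Bi _ _ _ _ _ _))//.
  by ring.
move=> p pR e e0; have [k [l [m crp]]] := cr p pR.
have [r r0 rAB] := crp (e / 4) (divr_gt0 e0 (ltr0n _ 4)).
exists r => // a' b' c' d' sub [/= p1 p2] br dr.
have [xa xb yc yd] := corners _ _ _ _ sub.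
have [aa ab' bb [cc cd' dd]] := sub.
have iAc := Ai a' b' c' aa bb yc; have iAd := Ai a' b' d' aa bb yd.
have iBa := Bi c' d' a' cc dd xa; have iBb := Bi c' d' b' cc dd xb.
pose s := (b' - a') + (d' - c').
have Ae q : rect a' b' c' d' q ->
    `|A q - A p - (k * (q.1 - p.1) + l * (q.2 - p.2))| <= e / 4 * s /\
    `|B q - B p - (m * (q.2 - p.2) - l * (q.1 - p.1))| <= e / 4 * s.
  move=> [q1 q2].
  have d1 : `|q.1 - p.1| <= b' - a'.
    by clear - q1 p1; rewrite ler_norml; lra.
  have d2 : `|q.2 - p.2| <= d' - c'.
    by clear - q2 p2; rewrite ler_norml; lra.
  have [h1 h2] := rAB q (le_lt_trans d1 br) (le_lt_trans d2 dr).
  by split; [apply: (le_trans h1)|apply: (le_trans h2)];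
    rewrite ler_wpM2l ?divr_ge0 ?(ltW e0)// lerD.
have s0 : 0 <= s by rewrite addr_ge0// subr_ge0.
have es0 : 0 <= e / 2 * s by rewrite mulr_ge0// divr_ge0// ltW.
have Aint : `|(\int[leb]_(x in `[a', b']) A (x, c') -
    \int[leb]_(x in `[a', b']) A (x, d')) - l * (c' - d') * (b' - a')| <=
    e / 2 * s * (b' - a').
  rewrite -RintegralB//; apply: Rintegral_itv_approx => //.
    rewrite (_ : EFin \o _ = ((EFin \o (fun x => A (x, c'))) \-
      (EFin \o (fun x => A (x, d'))))%E)//; exact: integrableB.
  move=> x xab.
  have [+ _] := Ae (x, c') (conj xab (introT andP (conj (lexx _) cd'))).
  have [+ _] := Ae (x, d') (conj xab (introT andP (conj cd' (lexx _)))).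
  by clear; rewrite /= !ler_norml; lra.
have Bint : `|(\int[leb]_(y in `[c', d']) B (b', y) -
    \int[leb]_(y in `[c', d']) B (a', y)) - l * (a' - b') * (d' - c')| <=
    e / 2 * s * (d' - c').
  rewrite -RintegralB//; apply: Rintegral_itv_approx => //.
    rewrite (_ : EFin \o _ = ((EFin \o (fun y => B (b', y))) \-
      (EFin \o (fun y => B (a', y))))%E)//; exact: integrableB.
  move=> y ycd.
  have [_ +] := Ae (a', y) (conj (introT andP (conj (lexx _) ab')) ycd).
  have [_ +] := Ae (b', y) (conj (introT andP (conj ab' (lexx _))) ycd).
  by clear; rewrite /= !ler_norml; lra.
rewrite /J -/s.
have -> : e * s ^+ 2 =
    e / 2 * s * (b' - a') + e / 2 * s * (d' - c') + e / 2 * s * s.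
  by rewrite /s; field.
have : 0 <= e / 2 * s * s by rewrite mulr_ge0.
by move: Aint Bint; clear; rewrite !ler_norml; lra.
Qed.

End Goursat.

(** * Bounded measurable functions, Fubini and integration by parts *)

Section BoundedMeasurable.
Context {R : realType}.

Section Generic.
Context {d} {T : measurableType d}.
Implicit Types (D : set T) (f g : T -> R).

(** Closed under products, and integrable on sets of finite measure: no other
    integrability argument is needed in a rectangle. *)
Definition bmeas D f := measurable_fun D f /\ exists M, forall x, D x -> `|f x| <= M.

Lemma bmeas_cst D (k : R) : bmeas D (fun=> k).
Proof. by split; [exact: measurable_cst|exists `|k|]. Qed.

Lemma bmeasD D f g : bmeas D f -> bmeas D g -> bmeas D (fun x => f x + g x).
Proof.
move=> [mf [M fM]] [mg [N gN]]; split; first exact: measurable_funD.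
by exists (M + N) => x Dx; rewrite (le_trans (ler_normD _ _))// lerD ?fM ?gN.
Qed.

Lemma bmeasM D f g : bmeas D f -> bmeas D g -> bmeas D (fun x => f x * g x).
Proof.
move=> [mf [M fM]] [mg [N gN]]; split; first exact: measurable_funM.
by exists (M * N) => x Dx; rewrite normrM ler_pM// ?fM ?gN.
Qed.

Lemma bmeasB D f g : bmeas D f -> bmeas D g -> bmeas D (fun x => f x - g x).
Proof.
move=> fD gD; have := bmeasD fD (bmeasM (bmeas_cst D (-1)) gD).
by congr bmeas; apply/funext => x; rewrite mulN1r.
Qed.

Lemma bmeasS D E f : measurable D -> E `<=` D -> bmeas D f -> bmeas E f.
Proof.
move=> mD ED [mf [M fM]]; split; last by exists M => x /ED; exact: fM.
exact: measurable_funS mf.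
Qed.

Lemma eq_bmeas D f g : (forall x, D x -> f x = g x) -> bmeas D f -> bmeas D g.
Proof.
move=> fg [mf [M fM]]; split; last by exists M => x Dx; rewrite -fg// fM.
by apply: eq_measurable_fun mf => x; rewrite inE => /fg.
Qed.

Lemma bmeas_integrable (mu : {measure set T -> \bar R}) D f : measurable D ->
  (mu D < +oo)%E -> bmeas D f -> mu.-integrable D (EFin \o f).
Proof.
move=> mD muD [mf [M fM]]; apply: measurable_bounded_integrable => //.
exists M; split; first exact: num_real.
by move=> N /ltW MN x Dx; exact: le_trans (fM x Dx) MN.
Qed.

End Generic.

Local Notation T := (measurableTypeR R * measurableTypeR R)%type.
Local Notation leb := (@lebesgue_measure R).

Lemma bmeas_fst (D E : set (measurableTypeR R)) (f : measurableTypeR R -> R) :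
  measurable D -> measurable E -> bmeas D f -> bmeas (D `*` E) (fun p : T => f p.1).
Proof.
move=> mD mE [mf [M fM]]; split; last by exists M => -[x y] [Dx _]; exact: fM.
apply: (measurable_comp mD _ mf) => //; first by move=> _ [[x y] [Dx _] <-].
exact: measurable_funTS.
Qed.

Lemma bmeas_snd (D E : set (measurableTypeR R)) (f : measurableTypeR R -> R) :
  measurable D -> measurable E -> bmeas E f -> bmeas (D `*` E) (fun p : T => f p.2).
Proof.
move=> mD mE [mf [M fM]]; split; last by exists M => -[x y] [_ Ey]; exact: fM.
apply: (measurable_comp mE _ mf) => //; first by move=> _ [[x y] [_ Ey] <-].
exact: measurable_funTS.
Qed.

Section Fubini.
Variables (D E : set (measurableTypeR R)).
Hypotheses (mD : measurable D) (mE : measurable E).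
Hypotheses (finD : (leb D < +oo)%E) (finE : (leb E < +oo)%E).
Variables (f : T -> R) (fDE : bmeas (D `*` E) f).

Let mDE : measurable (D `*` E). Proof. exact: measurableX. Qed.

Let finDE : (area (D `*` E) < +oo)%E.
Proof. by rewrite /area product_measure1E// lte_mul_pinfty// ge0_fin_numE. Qed.

Let mF : measurable_fun setT (f \_ (D `*` E)).
Proof. by case: fDE => mf _; exact: (iffLR (measurable_restrictT f mDE)). Qed.

Lemma bmeas_hsection y : E y -> bmeas D (fun x => f (x, y)).
Proof.
move=> Ey; split; last by case: fDE => _ [M fM]; exists M => x Dx; exact: fM.
have := measurable_funTS (measurable_fun_pair1 y mF) : measurable_fun D _.
by apply: eq_measurable_fun => x; rewrite inE => Dx; rewrite patchE mem_set.
Qed.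

Lemma bmeas_vsection x : D x -> bmeas E (fun y => f (x, y)).
Proof.
move=> Dx; split; last by case: fDE => _ [M fM]; exists M => y Ey; exact: fM.
have := measurable_funTS (measurable_fun_pair2 x mF) : measurable_fun E _.
by apply: eq_measurable_fun => y; rewrite inE => Ey; rewrite patchE mem_set.
Qed.

Let iF : (leb \x leb)%E.-integrable setT (EFin \o f \_ (D `*` E)).
Proof.
rewrite -restrict_EFin; apply: (iffLR (integrable_mkcond _ _)) => //.
exact: (bmeas_integrable mDE finDE fDE).
Qed.

Let FE x : fubini_F leb (EFin \o f \_ (D `*` E)) x =
  (((fun x => \int[leb]_(y in E) f (x, y)) \_ D) x)%:E.
Proof.
rewrite /fubini_F patchE; case: ifPn => [|] xD.
  rewrite /Rintegral fineK; last first.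
    apply: integrable_fin_num => //; apply: (bmeas_integrable mE finE).
    by apply: bmeas_vsection; exact: set_mem.
  rewrite [RHS]integral_mkcond; apply: eq_integral => y _ /=.
  by rewrite !patchE in_setX xD /=; case: ifPn.
by rewrite integral0_eq// => y _ /=; rewrite patchE in_setX (negbTE xD).
Qed.

Let GE y : fubini_G leb (EFin \o f \_ (D `*` E)) y =
  (((fun y => \int[leb]_(x in D) f (x, y)) \_ E) y)%:E.
Proof.
rewrite /fubini_G patchE; case: ifPn => [|] yE.
  rewrite /Rintegral fineK; last first.
    apply: integrable_fin_num => //; apply: (bmeas_integrable mD finD).
    by apply: bmeas_hsection; exact: set_mem.
  rewrite [RHS]integral_mkcond; apply: eq_integral => x _ /=.
  by rewrite !patchE in_setX yE andbT /=; case: ifPn.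
by rewrite integral0_eq// => x _ /=; rewrite patchE in_setX (negbTE yE) andbF.
Qed.

Lemma Rfubini1 : \int[area]_(p in D `*` E) f p =
  \int[leb]_(x in D) \int[leb]_(y in E) f (x, y).
Proof.
rewrite Rintegral_mkcond [RHS]Rintegral_mkcond /Rintegral; congr fine.
by rewrite -(integral12_prod_meas1 iF); apply: eq_integral => x _; exact: FE.
Qed.

Lemma Rfubini2 : \int[area]_(p in D `*` E) f p =
  \int[leb]_(y in E) \int[leb]_(x in D) f (x, y).
Proof.
rewrite Rintegral_mkcond [RHS]Rintegral_mkcond /Rintegral; congr fine.
by rewrite -(integral21_prod_meas1 iF); apply: eq_integral => y _; exact: GE.
Qed.

End Fubini.

Lemma lebesgue_itv_fin c d : (leb (`[c, d]%classic : set (measurableTypeR R)) < +oo)%E.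
Proof. by rewrite lebesgue_measure_itv/=; case: ifP => _; rewrite -?EFinB ltry. Qed.

Lemma bmeas_primitive a b (h : R -> R) : a <= b ->
  bmeas (`[a, b] : set (measurableTypeR R)) h ->
  bmeas (`[a, b] : set (measurableTypeR R)) (fun x => \int[leb]_(s in `[a, x]) h s).
Proof.
move=> ab hb; have [_ [M hM]] := hb; split.
  apply: subspace_continuous_measurable_fun => //.
  apply: parameterized_integral_continuous => //.
  by apply: bmeas_integrable hb => //; exact: lebesgue_itv_fin.
exists (`|M| * (b - a)) => x; rewrite /= in_itv/= => /andP[ax xb].
have hx : bmeas (`[a, x]%classic : set (measurableTypeR R)) h.
  apply: bmeasS hb => // s /=.
  by rewrite !in_itv/= => /andP[-> /le_trans]; apply.
have hxi : leb.-integrable `[a, x] (EFin \o h).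
  by apply: bmeas_integrable hx => //; exact: lebesgue_itv_fin.
have := @Rintegral_itv_approx R h a x 0 `|M| ax (normr_ge0 _) hxi.
rewrite mul0r subr0; move=> H; apply: le_trans (H _) _; last first.
  by rewrite ler_wpM2l// lerD2r.
move=> s /andP[as_ sx]; rewrite subr0 (le_trans (hM s _))// ?ler_norm//.
by rewrite /= in_itv/= as_ (le_trans sx).
Qed.

(** Integration by parts for the primitives of two functions that need not be
    continuous: Fubini's theorem on the square cut along its diagonal. *)
Lemma Rintegral_parts a b (h u : R -> R) : a <= b ->
  bmeas (`[a, b] : set (measurableTypeR R)) h ->
  bmeas (`[a, b] : set (measurableTypeR R)) u ->
  \int[leb]_(x in `[a, b]) (h x * \int[leb]_(s in `[a, x]) u s) =
  (\int[leb]_(x in `[a, b]) u x) * (\int[leb]_(x in `[a, b]) h x) -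
  \int[leb]_(x in `[a, b]) (u x * \int[leb]_(s in `[a, x]) h s).
Proof.
move=> ab hb ub.
set I := (`[a, b]%classic : set (measurableTypeR R)) in hb ub *.
have mI : measurable I by exact: measurable_itv.
have finI : (leb I < +oo)%E by exact: lebesgue_itv_fin.
pose K (p : T) := if p.2 <= p.1 then h p.1 * u p.2 else 0.
have KI : bmeas (I `*` I) K.
  have [mhu [M huM]] := bmeasM (bmeas_fst mI mI hb) (bmeas_snd mI mI ub).
  split.
    apply: measurable_fun_if => //; first exact: measurableX.
    - by apply: measurable_fun_ler; apply: measurable_funTS.
    - by apply: measurable_funS mhu; [exact: measurableX|move=> p []].
  exists `|M| => p Ip; rewrite /K; case: ifP => _; last by rewrite normr0.
  by rewrite (le_trans (huM p Ip))// ler_norm.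
have hi (x : R) : I x -> bmeas (`[a, x] : set (measurableTypeR R)) h /\
    bmeas (`[a, x] : set (measurableTypeR R)) u.
  rewrite /I/= in_itv/= => /andP[ax xb].
  by split; [move: hb|move: ub]; apply: bmeasS => // s;
    rewrite /I/= !in_itv/= => /andP[-> /le_trans]; apply.
have -> : \int[leb]_(x in I) (h x * \int[leb]_(s in `[a, x]) u s) =
    \int[leb]_(x in I) \int[leb]_(s in I) K (x, s).
  apply: eq_Rintegral => x; rewrite inE => Ix; have [_ ux] := hi x Ix.
  rewrite -RintegralZl//; last first.
    by apply: bmeas_integrable ux => //; exact: lebesgue_itv_fin.
  rewrite [LHS]Rintegral_mkcond [RHS]Rintegral_mkcond; apply: eq_Rintegral => s _.
  move: Ix; rewrite !patchE /K !mem_setE/= /I/= !in_itv/= => /andP[ax xb].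
  case: (leP a s) => //= as_; case: (leP s x) => [sx|xs]; last by rewrite if_same.
  by rewrite (le_trans sx xb).
rewrite -Rfubini1// Rfubini2//.
rewrite -RintegralZr//; last exact: bmeas_integrable.
rewrite -RintegralB//; last 2 first.
- apply: (bmeas_integrable mI finI); apply: bmeasM => //; exact: bmeas_cst.
- apply: (bmeas_integrable mI finI); apply: bmeasM => //.
  exact: bmeas_primitive.
apply: eq_Rintegral => s; rewrite inE => Is; have [hs _] := hi s Is.
have hbi := bmeas_integrable mI finI hb.
move: (Is); rewrite /I/= in_itv/= => /andP[as_ sb].
rewrite (Rintegral_itv_split as_ sb hbi) mulrDr addrAC subrr add0r.
have hsb : bmeas (`[s, b]%classic : set (measurableTypeR R)) h.
  apply: bmeasS hb => // x /=.
  by rewrite /I/= !in_itv/= => /andP[sx ->]; rewrite (le_trans as_).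
rewrite -RintegralZl//; last first.
  by apply: bmeas_integrable hsb => //; exact: lebesgue_itv_fin.
rewrite [LHS]Rintegral_mkcond [RHS]Rintegral_mkcond; apply: eq_Rintegral => x _.
rewrite !patchE /K !mem_setE/= /I/= !in_itv/= (mulrC (u s)).
case: (leP x b) => [xb|]; last by rewrite !andbF.
rewrite !andbT; case: (leP s x) => [sx|xs]; last by rewrite if_same.
by rewrite (le_trans as_ sx).
Qed.

End BoundedMeasurable.

(** * The weak Cauchy-Riemann equations *)

Section WeakForm.
Context {R : realType}.
Local Notation T := (measurableTypeR R * measurableTypeR R)%type.
Local Notation leb := (@lebesgue_measure R).
Local Notation itv a b := (`[a, b]%classic : set (measurableTypeR R)).

Variables (A B : T -> R) (a b c d : R) (ab : a <= b) (cd : c <= d).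
Hypothesis cr : forall p, rect a b c d p -> cr_at A B p.
Variables (u v : R -> R) (bu : bmeas (itv a b) u) (bv : bmeas (itv c d) v).
Hypothesis u0 : \int[leb]_(x in `[a, b]) u x = 0.
Hypothesis v0 : \int[leb]_(y in `[c, d]) v y = 0.

Let f x := \int[leb]_(s in `[a, x]) u s.
Let g y := \int[leb]_(t in `[c, y]) v t.
Let X := itv a b.
Let Y := itv c d.
Let mX : measurable X. Proof. exact: measurable_itv. Qed.
Let mY : measurable Y. Proof. exact: measurable_itv. Qed.
Let finX : (leb X < +oo)%E. Proof. exact: lebesgue_itv_fin. Qed.
Let finY : (leb Y < +oo)%E. Proof. exact: lebesgue_itv_fin. Qed.

Let inX x : X x = (a <= x <= b) :> Prop. Proof. by rewrite /X/= in_itv. Qed.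
Let inY y : Y y = (c <= y <= d) :> Prop. Proof. by rewrite /Y/= in_itv. Qed.

Lemma cont_at_rect_bmeas (h : T -> R) : (forall p, rect a b c d p -> cont_at h p) ->
  bmeas (X `*` Y) h.
Proof.
move=> ch; rewrite -rectE; split; last first.
  by apply: cont_within_rect_bounded => p /ch/cont_at_within; exact.
apply: cont_within_measurable; first exact: measurable_rect.
by move=> p /ch/cont_at_within; exact.
Qed.

Let bA : bmeas (X `*` Y) A.
Proof. by apply: cont_at_rect_bmeas => p /cr/cr_at_cont[]. Qed.
Let bB : bmeas (X `*` Y) B.
Proof. by apply: cont_at_rect_bmeas => p /cr/cr_at_cont[]. Qed.

Let PA (p : T) := \int[leb]_(s in `[a, p.1]) A (s, p.2).
Let PB (p : T) := \int[leb]_(t in `[c, p.2]) B (p.1, t).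

Let prim_diff (h : R -> R) l r M x x' : bmeas (itv l r) h ->
  (forall s, itv l r s -> `|h s| <= M) ->
  l <= x <= r -> l <= x' <= r ->
  `|\int[leb]_(s in `[l, x]) h s - \int[leb]_(s in `[l, x']) h s| <= M * `|x - x'|.
Proof.
move=> bh hM.
wlog xx : x x' / x' <= x.
  move=> H; have [xx|/ltW xx] := leP x' x; first exact: H.
  by move=> hx hx'; rewrite distrC (distrC x); exact: H xx hx' hx.
move=> /andP[lx xr] /andP[lx' _].
have sub m n : l <= m -> n <= r -> bmeas (itv m n) h.
  move=> lm nr; apply: bmeasS bh => // s /=.
  by rewrite !in_itv/= => /andP[ms sn]; rewrite (le_trans lm)//= (le_trans sn).
have subi m n : l <= m -> n <= r -> leb.-integrable `[m, n] (EFin \o h).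
  by move=> lm nr; apply: bmeas_integrable (sub _ _ lm nr) => //; exact: lebesgue_itv_fin.
rewrite (Rintegral_itv_split lx' xx (subi _ _ _ _))// addrAC subrr add0r.
rewrite [X in _ * X]ger0_norm ?subr_ge0//.
have M0 : 0 <= M by rewrite (le_trans _ (hM x _))//= in_itv/= lx.
have H := @Rintegral_itv_approx R h x' x 0 M xx M0 (subi _ _ lx' xr).
rewrite mul0r subr0 in H; apply: H => s /andP[xs sx].
by rewrite subr0 hM//= in_itv/= (le_trans lx')//= (le_trans sx).
Qed.

Let goursat_prim x y : X x -> Y y -> PB (x, y) = PA (x, c) + PB (a, y) - PA (x, y).
Proof.
rewrite inX inY => /andP[ax xb] /andP[cy yd].
have := @goursat R A B a x c y ax cy; rewrite /PA /PB/= => H.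
rewrite addrAC H ?subrK// => p [/andP[p1 p2] /andP[q1 q2]].
by apply: cr; split; rewrite ?p1 ?q1/= ?(le_trans p2) ?(le_trans q2).
Qed.

(* [PA] is Lipschitz in [x] because [A] is bounded, and in [y] because
   Goursat's theorem turns it into [PB]; hence it is jointly measurable *)
Let bPA : bmeas (X `*` Y) PA.
Proof.
have [_ [M AM]] := bA; have [_ [N BN]] := bB.
have Xa : X a by rewrite inX lexx.
have Yc : Y c by rewrite inY lexx.
rewrite -rectE in AM BN *.
have dx x x' y : X x -> X x' -> Y y -> `|PA (x, y) - PA (x', y)| <= `|M| * `|x - x'|.
  rewrite !inX => Xx Xx' Yy.
  apply: prim_diff Xx Xx'; first exact: (bmeas_hsection mX mY bA).
  move=> s; rewrite -/(X s) inX inY in Yy * => Xs.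
  by rewrite (le_trans (AM _ _)) ?ler_norm.
have dy x y y' : X x -> Y y -> Y y' -> `|PB (x, y) - PB (x, y')| <= `|N| * `|y - y'|.
  move=> Xx; rewrite !inY => Yy Yy'.
  apply: prim_diff Yy Yy'; first exact: (bmeas_vsection mX mY bB).
  move=> s; rewrite -/(Y s) inX inY in Xx * => Xs.
  by rewrite (le_trans (BN _ _)) ?ler_norm.
have lip x x' y y' : X x -> X x' -> Y y -> Y y' ->
    `|PA (x', y') - PA (x, y)| <= `|M| * `|x' - x| + 2 * `|N| * `|y' - y|.
  move=> Xx Xx' Yy Yy'.
  have h1 := dx x' x y' Xx' Xx Yy'.
  have h2 := dy x y' y Xx Yy' Yy; have h3 := dy a y' y Xa Yy' Yy.
  have e1 := goursat_prim Xx Yy; have e2 := goursat_prim Xx Yy'.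
  have -> : PA (x', y') - PA (x, y) = (PA (x', y') - PA (x, y')) +
     ((PB (a, y') - PB (a, y)) - (PB (x, y') - PB (x, y))) by rewrite e1 e2; ring.
  rewrite (le_trans (ler_normD _ _))// lerD// (le_trans (ler_normB _ _))//.
  by rewrite -mulrA mulr_natl mulr2n lerD.
have cw p : rect a b c d p -> cont_within (rect a b c d) PA p.
  case: p => x y [/= xX yY] e e0.
  pose K := `|M| + 2 * `|N| + 1.
  have K0 : 0 < K by rewrite /K ltr_wpDl// addr_ge0// mulr_ge0.
  exists (e / K); first by rewrite divr_gt0.
  move=> [x' y'] [/= xX' yY'] xe ye.
  have := @lip x x' y y'; rewrite !inX !inY => /(_ xX xX' yY yY')/le_lt_trans; apply.
  apply: (@le_lt_trans _ _ ((`|M| + 2 * `|N|) * (e / K))).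
    by rewrite [leRHS]mulrDl lerD// ler_wpM2l ?mulr_ge0// ltW.
  by rewrite mulrA ltr_pdivrMr// mulrC ltr_pM2l// /K ltrDl.
split; last exact: cont_within_rect_bounded.
by apply: cont_within_measurable => //; exact: measurable_rect.
Qed.

Let bf : bmeas X f. Proof. exact: bmeas_primitive. Qed.
Let bg : bmeas Y g. Proof. exact: bmeas_primitive. Qed.
Let liftX h := @bmeas_fst R X Y h mX mY.
Let liftY h := @bmeas_snd R X Y h mX mY.

Let bPAc : bmeas X (fun x => PA (x, c)).
Proof. by apply: (bmeas_hsection mX mY bPA); rewrite inY lexx. Qed.
Let bPBa : bmeas Y (fun y => PB (a, y)).
Proof.
apply: (@bmeas_primitive R c d (fun t => B (a, t)) cd).
by apply: (bmeas_vsection mX mY bB); rewrite inX lexx.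
Qed.

(** The weak form of a Cauchy-Riemann equation. For [F = f (x) g (y)], which
    vanishes on the boundary of the rectangle, it reads
    [int (A dF/dy + B dF/dx) = 0]. The derivatives of [A] and [B] need not be
    integrable, so these functions cannot be integrated by parts; instead,
    Goursat's theorem for the rectangles with corners [(a, c)] and [(x, y)] is
    averaged with weight [u (x) v (y)]. The two sides through [(a, c)] drop out,
    because [u] and [v] have integral 0, and integration by parts against [u]
    and [v] turns the other two into the integral at hand. *)
Lemma weak_cauchy_riemann :
  \int[area]_(p in rect a b c d) (A p * (f p.1 * v p.2) + B p * (u p.1 * g p.2)) = 0.
Proof.
rewrite rectE.
have mXY : measurable (X `*` Y) by exact: measurableX.
have finXY : (area (X `*` Y) < +oo)%E.
  by rewrite /area product_measure1E// lte_mul_pinfty// ge0_fin_numE.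
have b1 : bmeas (X `*` Y) (fun p => A p * (f p.1 * v p.2)).
  exact: bmeasM bA (bmeasM (liftX bf) (liftY bv)).
have b2 : bmeas (X `*` Y) (fun p => B p * (u p.1 * g p.2)).
  exact: bmeasM bB (bmeasM (liftX bu) (liftY bg)).
have b3 : bmeas (X `*` Y) (fun p => u p.1 * (v p.2 * PA p)).
  exact: bmeasM (liftX bu) (bmeasM (liftY bv) bPA).
rewrite RintegralD//; last 2 first.
- exact: bmeas_integrable b1.
- exact: bmeas_integrable b2.
rewrite (Rfubini2 mX mY finX finY b1) (Rfubini1 mX mY finX finY b2).
have bPB : bmeas (X `*` Y) PB.
  apply: (eq_bmeas (f := fun p : T => PA (p.1, c) + PB (a, p.2) - PA p)).
    by move=> -[x y] [Xx Yy]; rewrite [RHS]goursat_prim.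
  exact: bmeasB (bmeasD (liftX bPAc) (liftY bPBa)) bPA.
have b4 : bmeas (X `*` Y) (fun p => u p.1 * (v p.2 * PB p)).
  exact: bmeasM (liftX bu) (bmeasM (liftY bv) bPB).
have bN (h : T -> R) : bmeas (X `*` Y) h -> bmeas (X `*` Y) (fun p => - 1 * h p).
  by apply: bmeasM; exact: bmeas_cst.
have -> : \int[leb]_(y in Y) \int[leb]_(x in X) (A (x, y) * (f x * v y)) =
    \int[area]_(p in X `*` Y) (- 1 * (u p.1 * (v p.2 * PA p))).
  rewrite (Rfubini2 mX mY finX finY (bN _ b3)).
  apply: eq_Rintegral => y /set_mem Yy.
  have bAy := bmeas_hsection mX mY bA Yy.
  have bPAy := bmeas_hsection mX mY bPA Yy.
  transitivity (\int[leb]_(x in X) (A (x, y) * f x * v y)).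
    by apply: eq_Rintegral => x _; rewrite mulrA.
  rewrite RintegralZr//; last by apply: bmeas_integrable (bmeasM bAy bf).
  rewrite Rintegral_parts// u0 mul0r sub0r -[X in X * _ = _]mulN1r.
  rewrite -RintegralZl//; last by apply: bmeas_integrable (bmeasM bu bPAy).
  rewrite -RintegralZr//; last first.
    by apply: bmeas_integrable (bmeasM (bmeas_cst _ (-1)) (bmeasM bu bPAy)).
  by apply: eq_Rintegral => x _ /=; rewrite /PA/=; ring.
have -> : \int[leb]_(x in X) \int[leb]_(y in Y) (B (x, y) * (u x * g y)) =
    \int[area]_(p in X `*` Y) (- 1 * (u p.1 * (v p.2 * PB p))).
  rewrite (Rfubini1 mX mY finX finY (bN _ b4)).
  apply: eq_Rintegral => x /set_mem Xx.
  have bBx := bmeas_vsection mX mY bB Xx.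
  have bPBx := bmeas_vsection mX mY bPB Xx.
  transitivity (\int[leb]_(y in Y) (B (x, y) * g y * u x)).
    by apply: eq_Rintegral => y _; ring.
  rewrite RintegralZr//; last by apply: bmeas_integrable (bmeasM bBx bg).
  rewrite Rintegral_parts// v0 mul0r sub0r -[X in X * _ = _]mulN1r.
  rewrite -RintegralZl//; last by apply: bmeas_integrable (bmeasM bv bPBx).
  rewrite -RintegralZr//; last first.
    by apply: bmeas_integrable (bmeasM (bmeas_cst _ (-1)) (bmeasM bv bPBx)).
  by apply: eq_Rintegral => y _ /=; rewrite /PB/=; ring.
rewrite -RintegralD//; last 2 first.
- exact: bmeas_integrable (bN _ b3).
- exact: bmeas_integrable (bN _ b4).
have c1 : bmeas (X `*` Y) (fun p => -1 * (u p.1 * PA (p.1, c)) * v p.2).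
  exact: bmeasM (bN _ (liftX (bmeasM bu bPAc))) (liftY bv).
have c2 : bmeas (X `*` Y) (fun p => -1 * (v p.2 * PB (a, p.2)) * u p.1).
  exact: bmeasM (bN _ (liftY (bmeasM bv bPBa))) (liftX bu).
transitivity (\int[area]_(p in X `*` Y) (-1 * (u p.1 * PA (p.1, c)) * v p.2 +
    -1 * (v p.2 * PB (a, p.2)) * u p.1)).
  apply: eq_Rintegral => -[x y] /set_mem[/= Xx Yy].
  by rewrite (goursat_prim Xx Yy); ring.
rewrite RintegralD//; last 2 first.
- exact: bmeas_integrable c1.
- exact: bmeas_integrable c2.
rewrite (Rfubini1 mX mY finX finY c1) (Rfubini2 mX mY finX finY c2).
have ui : leb.-integrable X (EFin \o u) by exact: bmeas_integrable bu.
have vi : leb.-integrable Y (EFin \o v) by exact: bmeas_integrable bv.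
rewrite (_ : (fun x => _) = cst 0) ?[X in _ + X](_ : _ = 0) ?addr0.
- by rewrite /cst Rintegral_cst// mul0r.
- transitivity (\int[leb]_(y in Y) 0); last by rewrite Rintegral_cst// mul0r.
  by apply: eq_Rintegral => y _ /=; rewrite RintegralZl// u0 mulr0.
- by apply/funext => x /=; rewrite RintegralZl// v0 mulr0.
Qed.

End WeakForm.

(** * Bumps that vary on a Cantor set *)

Section CantorBump.
Context {R : realType}.
Local Notation leb := (@lebesgue_measure R).
Local Notation itv a b := (`[a, b]%classic : set (measurableTypeR R)).

Definition thin_line (K : set R) := forall l r, l < r ->
  exists l' r', [/\ l <= l', l' < r', r' <= r & forall x, l' <= x <= r' -> ~ K x].

(** A closed set of almost full measure without interior: the complement of a
    small open neighbourhood of the rational numbers. *)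
Lemma fat_cantor (e : R) : 0 < e -> exists K : set (measurableTypeR R),
  [/\ measurable K, thin_line K & (leb (~` K) < e%:E)%E].
Proof.
move=> e0.
have Q0 : leb (range ratr) = 0%E by exact: lebesgue_measure_rat.
have mQ : measurable (range ratr : set (measurableTypeR R)).
  apply: countable_measurable; first by move=> x; exact: measurable_set1.
  by apply: (card_le_trans (card_image_le _ _)); exact: countableP.
have Qfin : (leb (range ratr) < +oo)%E by rewrite Q0.
have [U [oU QU Ue]] := lebesgue_regularity_outer mQ Qfin e0.
have mU : measurable (U : set (measurableTypeR R)).
  exact: measurable_realfun.open_measurable.
exists (~` U); split; first exact: measurableC.
- move=> l r /rat_in_itvoo[q /[!in_itv]/= /andP[lq qr]].
  have : U (ratr q) by apply: QU; exists q.
  move: oU; rewrite openE => /[apply] /nbhs_ballP[d /= d0 dU].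
  pose s := Num.min (d / 2) (Num.min (ratr q - l) (r - ratr q)).
  have s0 : 0 < s by rewrite !lt_min !subr_gt0 lq qr divr_gt0.
  have [sd [sl sr]] : s <= d / 2 /\ s <= ratr q - l /\ s <= r - ratr q.
    by rewrite /s !ge_min !lexx !orbT.
  exists (ratr q - s), (ratr q + s); split; [lra|lra|lra|].
  move=> x xq nUx; apply: nUx; apply: dU; rewrite -ball_normE/= ltr_norml.
  lra.
- rewrite setCK; apply: le_lt_trans Ue.
  have -> : leb U = leb ((U `\` range ratr) `|` range ratr).
    by rewrite setUC setDUK.
  rewrite (le_trans (measureU2 _ _ _))//; first exact: measurableD.
  by rewrite [X in (_ + X)%E](_ : _ = 0%E) ?adde0.
Qed.

(** [u] is the derivative of a bump that vanishes at [a] and [b] and is 1 on the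
    plateau between [m] and [n]. All the variation of the bump takes place on
    the Cantor set [K], and [A] is a part of [K] of positive measure on which
    the bump has constant slope [k]. *)
Record cantor_bump (a b : R) (K : set R) (u : R -> R)
    (A : set (measurableTypeR R)) (k m n : R) : Prop := {
  bump_thin : thin_line K ;
  bump_supp : forall x, u x != 0 -> K x /\ a <= x <= b ;
  bump_bmeas : bmeas (setT : set (measurableTypeR R)) u ;
  bump_int0 : \int[leb]_(x in `[a, b]) u x = 0 ;
  bump_block : [/\ measurable A, (0 < leb A)%E & A `<=` `[a, b]] ;
  bump_k0 : 0 < k ;
  bump_uA : forall x, A x -> u x = k ;
  bump_mn : [/\ a <= m, m < n & n <= b] ;
  bump_plateau : forall x, m <= x <= n -> u x = 0 /\ \int[leb]_(s in `[a, x]) u s = 1 }.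

Lemma Rintegral_indic (D A : set (measurableTypeR R)) : measurable D -> measurable A ->
  \int[leb]_(x in D) \1_A x = fine (leb (A `&` D)).
Proof. by move=> mD mA; rewrite /Rintegral integral_indic. Qed.

Lemma bmeas_indic (D A : set (measurableTypeR R)) :
  measurable A -> bmeas D (\1_A : _ -> R).
Proof.
move=> mA; split; first exact: measurable_indic.
by exists 1 => x _; rewrite indicE; case: (_ \in _); rewrite ?normr1 ?normr0.
Qed.

Lemma exists_cantor_bump a b : a < b -> exists K u A k m n, cantor_bump a b K u A k m n.
Proof.
move=> ab; pose w := (b - a) / 3.
have w0 : 0 < w by rewrite divr_gt0 ?subr_gt0.
have [K [mK thK Kw]] := fat_cantor w0.
pose m := a + w; pose n := b - w.
have [am mn nb] : [/\ a < m, m < n & n < b] by rewrite /m /n /w; split; lra.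
have pos_block (I : interval R) : leb [set` I] = w%:E ->
    (0 < leb (K `&` [set` I]))%E /\ leb (K `&` [set` I]) \is a fin_num.
  move=> Iw.
  have mI : measurable ([set` I] : set (measurableTypeR R)) by exact: measurable_itv.
  split.
    have h : (leb ([set` I] `&` ~` K) < leb [set` I])%E.
      rewrite Iw; apply: le_lt_trans Kw.
      apply: le_measure; rewrite ?inE//; last exact: measurableC.
      by apply: measurableI => //; exact: measurableC.
    rewrite lt0e measure_ge0 andbT; apply/eqP => K0.
    move: h; rewrite ltNge => /negP; apply.
    rewrite -[in leLHS](setIT [set` I]) -(setUCr K) setIUr.
    rewrite (le_trans (measureU2 _ _ _))//; first exact: measurableI.
      by apply: measurableI => //; exact: measurableC.
    by rewrite [X in (X + _)%E](_ : _ = 0%E) ?add0e// setIC.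
  rewrite ge0_fin_numE//; apply: (@le_lt_trans _ _ (leb [set` I])).
    by apply: le_measure; rewrite ?inE//; exact: measurableI.
  by rewrite Iw ltry.
have lI : leb `[a, m[ = w%:E.
  by rewrite lebesgue_measure_itv/= lte_fin am -EFinB /m addrAC subrr add0r.
have lJ : leb `]n, b] = w%:E.
  by rewrite lebesgue_measure_itv/= lte_fin nb -EFinB /n opprB addrCA subrr addr0.
set A := K `&` `[a, m[%classic; set B := K `&` `]n, b]%classic.
have mA : measurable (A : set (measurableTypeR R)).
  by apply: measurableI => //; exact: measurable_itv.
have mB : measurable (B : set (measurableTypeR R)).
  by apply: measurableI => //; exact: measurable_itv.
have [A0 Afin] := pos_block _ lI; have [B0 Bfin] := pos_block _ lJ.
rewrite -/A in A0 Afin; rewrite -/B in B0 Bfin.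
have [rA0 rB0] : 0 < fine (leb A) /\ 0 < fine (leb B).
  by split; apply: fine_gt0; rewrite ?A0 ?B0/= ltey_eq ?Afin ?Bfin.
set p := fine (leb A) in rA0; set q := fine (leb B) in rB0.
(* the bump rises on [A], left of the plateau, and falls on [B], right of it *)
pose u x := p^-1 * \1_A x - q^-1 * \1_B x.
have bA D : bmeas (D : set (measurableTypeR R)) (fun x => p^-1 * \1_A x).
  by apply: bmeasM; [exact: bmeas_cst|exact: bmeas_indic].
have bB D : bmeas (D : set (measurableTypeR R)) (fun x => q^-1 * \1_B x).
  by apply: bmeasM; [exact: bmeas_cst|exact: bmeas_indic].
have uint x : \int[leb]_(s in `[a, x]) u s =
    p^-1 * fine (leb (A `&` `[a, x])) - q^-1 * fine (leb (B `&` `[a, x])).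
  have mx : measurable (itv a x) by exact: measurable_itv.
  have fx := lebesgue_itv_fin a x.
  rewrite /u RintegralB//; last 2 first.
  - by apply: bmeas_integrable (bA _).
  - by apply: bmeas_integrable (bB _).
  rewrite !RintegralZl//; last 2 first.
  - by apply: bmeas_integrable (bmeas_indic _ mB).
  - by apply: bmeas_integrable (bmeas_indic _ mA).
  by rewrite !Rintegral_indic.
have AI x : m <= x -> A `&` `[a, x] = A.
  move=> mx; apply/setIidl => s [_]; rewrite /= !in_itv/= => /andP[-> sm].
  by rewrite (le_trans (ltW sm)).
exists K, u, A, p^-1, m, n; split => //.
- move=> x; apply: contra_neqP => H.
  have [nA nB] : ~ A x /\ ~ B x.
    split => -[Kx]; rewrite /= in_itv/= => /andP[x1 x2]; apply: H; split => //.
      by rewrite x1 (le_trans (ltW x2))// (le_trans (ltW mn))// ltW.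
    by rewrite x2 (le_trans _ (ltW x1))// (le_trans _ (ltW mn))// ltW.
  by rewrite /u !indicE !memNset// !mulr0 subr0.
- exact: bmeasB.
- rewrite uint AI; last by rewrite (le_trans (ltW mn))// ltW.
  rewrite (_ : B `&` _ = B); last first.
    apply/setIidl => s [_]; rewrite /= !in_itv/= => /andP[ns ->]; rewrite andbT.
    by rewrite (le_trans _ (ltW ns))// (le_trans _ (ltW mn))// ltW.
  by rewrite -/p -/q !mulVf ?subrr// gt_eqF.
- split => // x [_]; rewrite /= !in_itv/= => /andP[-> xm]/=.
  by rewrite (le_trans (ltW xm))// (le_trans (ltW mn))// ltW.
- by rewrite invr_gt0.
- move=> x Ax; rewrite /u !indicE mem_set// memNset ?mulr0 ?mulr1 ?subr0//.
  case: Ax => _; rewrite /= in_itv/= => /andP[_ xm] [_].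
  rewrite /= in_itv/= => /andP[nx _].
  by have := lt_trans xm (lt_trans mn nx); rewrite ltxx.
- by split => //; exact: ltW.
- move=> x /andP[mx xn]; split.
    rewrite /u !indicE !memNset ?mulr0 ?subr0//.
      by move=> [_]; rewrite /= in_itv/= ltNge xn.
    by move=> [_]; rewrite /= in_itv/= => /andP[_]; rewrite ltNge mx.
  rewrite uint AI// (_ : B `&` _ = set0) ?measure0 ?mulr0 ?subr0.
    by rewrite -/p mulVf// gt_eqF.
  apply/seteqP; split => // s [[_]]; rewrite /= !in_itv/= => /andP[ns _] /andP[_ sx].
  by have := lt_le_trans ns (le_trans sx xn); rewrite ltxx.
Qed.

End CantorBump.

(** * Thin functions orthogonal to holomorphic functions *)

Section Frame.
Context {R : realType}.
Local Notation T := (measurableTypeR R * measurableTypeR R)%type.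
Local Notation leb := (@lebesgue_measure R).
Local Notation itv a b := (`[a, b]%classic : set (measurableTypeR R)).
Implicit Types (S : set (plane R)) (phi eta : plane R -> plane R).

Lemma derivable_approx phi z : derivable phi z 1 -> exists L : plane R,
  forall e : R, 0 < e -> exists2 r : R, 0 < r & forall w, modulus (w - z) < r ->
    modulus (phi w - phi z - L * (w - z)) <= e * modulus (w - z).
Proof.
move=> /cvg_ex[L /cvgrPdist_lt dL]; exists L => e e0.
have /dL/nbhs_ballP[r /= r0 rL] : (0 : R[i]) < e%:C by rewrite ltcR.
have /complex_realP[s sE] := gtr0_real r0.
move: r0 rL; rewrite sE ltcR => s0 sL; exists s => // w ws.
have [->|wz] := eqVneq w z.
  by rewrite !subrr mulr0 subrr /modulus ComplexField.Normc.normc0 mulr0.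
have wz0 : w - z != 0 by rewrite subr_eq0.
have := sL (w - z); rewrite -ball_normE /= sub0r normrN normE ltcR => /(_ ws wz0).
rewrite [_ *: 1]mulr1 subrK => h.
have -> : phi w - phi z - L * (w - z) = - (L - (w - z)^-1 * (phi w - phi z)) * (w - z).
  by field.
rewrite modulusM modulusN ler_wpM2r ?modulus_ge0// ltW//.
by move: h; rewrite normE ltcR.
Qed.

Lemma derivable_cr phi (p : T) : derivable phi (toC p) 1 ->
  cr_at (fun q => Re (phi (toC q))) (fun q => Im (phi (toC q))) p /\
  cr_at (fun q => - Im (phi (toC q))) (fun q => Re (phi (toC q))) p.
Proof.
move=> /derivable_approx[[l m] H].
have mod_le (q : T) : modulus (toC q - toC p) <= `|q.1 - p.1| + `|q.2 - p.2|.
  exact: modulus_le_ReIm.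
have box (e : R) : 0 < e -> exists2 r : R, 0 < r & forall q : T,
    `|q.1 - p.1| < r -> `|q.2 - p.2| < r ->
    `|Re (phi (toC q)) - Re (phi (toC p)) -
        (l * (q.1 - p.1) - m * (q.2 - p.2))| <=
      e * (`|q.1 - p.1| + `|q.2 - p.2|) /\
    `|Im (phi (toC q)) - Im (phi (toC p)) -
        (l * (q.2 - p.2) + m * (q.1 - p.1))| <=
      e * (`|q.1 - p.1| + `|q.2 - p.2|).
  move=> e0; have [r r0 rH] := H e e0; exists (r / 2); first by rewrite divr_gt0.
  move=> q q1 q2.
  have /rH h : modulus (toC q - toC p) < r.
    by rewrite (le_lt_trans (mod_le q))// [ltRHS](splitr r) ltrD.
  split.
    apply: le_trans (ler_wpM2l (ltW e0) (mod_le q)); apply: le_trans h.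
    apply: le_trans (Re_le_modulus _).
    by case: (phi (toC q)) (phi (toC p)) => [? ?] [? ?].
  apply: le_trans (ler_wpM2l (ltW e0) (mod_le q)); apply: le_trans h.
  apply: le_trans (Im_le_modulus _).
  by case: (phi (toC q)) (phi (toC p)) => [? ?] [? ?].
split.
  exists l, (- m), l => e /box[r r0 rq]; exists r => // q q1 q2.
  by have [h1 h2] := rq q q1 q2; rewrite !mulNr opprK.
exists (- m), (- l), (- m) => e /box[r r0 rq]; exists r => // q q1 q2.
have [h1 h2] := rq q q1 q2; split.
  rewrite -normrN; apply: le_trans h2; rewrite le_eqVlt; apply/orP; left; apply/eqP.
  by congr `|_|; ring.
apply: le_trans h1; rewrite le_eqVlt; apply/orP; left; apply/eqP.
by congr `|_|; ring.
Qed.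

Lemma holomorphic_measurable S phi :
  open S -> holomorphic_on S phi -> measurable_on S phi.
Proof.
move=> oS hphi; split.
  apply: cont_within_measurable; first exact: open_measurable.
  move=> p Sp; have [cr1 _] := derivable_cr (hphi _ Sp).
  by apply: cont_at_within; exact: (cr_at_cont cr1).1.
apply: cont_within_measurable; first exact: open_measurable.
move=> p Sp; have [cr1 _] := derivable_cr (hphi _ Sp).
by apply: cont_at_within; exact: (cr_at_cont cr1).2.
Qed.

(** Nowhere density, in a form that is plainly stable under finite unions. *)
Definition thin (E : set T) := forall a b c d, a < b -> c < d ->
  exists a' b' c' d', [/\ a' < b', c' < d', rect a' b' c' d' `<=` rect a b c d
    & forall p, rect a' b' c' d' p -> ~ E p].

Lemma thin0 : thin set0.
Proof. by move=> a b c d ab cd; exists a, b, c, d; split=> // p _ []. Qed.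

Lemma thinU E F : thin E -> thin F -> thin (E `|` F).
Proof.
move=> tE tF a b c d ab cd.
have [a1 [b1 [c1 [d1 [ab1 cd1 s1 E1]]]]] := tE a b c d ab cd.
have [a2 [b2 [c2 [d2 [ab2 cd2 s2 F2]]]]] := tF a1 b1 c1 d1 ab1 cd1.
exists a2, b2, c2, d2; split => //; first exact: subset_trans s1.
by move=> p p2 [|]; [apply/E1/s2|exact: F2].
Qed.

(** What can be added to a Beltrami differential without leaving its class.
    The support is thin, to leave room for other annihilators; on a block of
    positive area the value is 1, so that adding a multiple has a definite
    effect on the modulus. *)
Record annihilator S (V : set T) eta : Prop := {
  ann_supp : forall p, eta (toC p) != 0 -> V p ;
  ann_thin : thin [set p | eta (toC p) != 0] ;
  ann_bmeas : bmeas setT (fun p => Re (eta (toC p))) /\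
              bmeas setT (fun p => Im (eta (toC p))) ;
  ann_block : exists P : set T, [/\ measurable P, (0 < area P)%E &
      forall p, P p -> eta (toC p) = 1] ;
  ann_orth : forall phi, holomorphic_on S phi ->
    cintegral S (fun z => eta z * phi z) = 0 }.

(** Up to the factor [k^-1], the function is [2 dbar (f (x) g (y))] for two
    Cantor bumps [f] and [g] with derivatives [u] and [v]: being a [dbar]
    derivative makes it orthogonal to holomorphic functions, and its real part
    [u g] and imaginary part [f v] live over the two Cantor sets. The block is
    where [u = k] and [g] is on its plateau, so that [g = 1] and [v = 0]. *)
Lemma exists_annihilator S a b c d : open S -> a < b -> c < d ->
  rect a b c d `<=` toC @^-1` S -> exists eta, annihilator S (rect a b c d) eta.
Proof.
move=> oS ab cd VS.
have [K [u [A [k [m [n H]]]]]] := exists_cantor_bump ab.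
have [L [v [B [l [m' [n' H']]]]]] := exists_cantor_bump cd.
pose f x := \int[leb]_(s in `[a, x]) u s.
pose g y := \int[leb]_(t in `[c, y]) v t.
pose V := rect a b c d.
have mV : measurable V by exact: measurable_rect.
pose re := (fun p : T => u p.1 * g p.2) \_ V.
pose im := (fun p : T => f p.1 * v p.2) \_ V.
pose eta (z : plane R) : plane R := k^-1 * re (Re z, Im z) +i* (k^-1 * im (Re z, Im z)).
have etaE p : eta (toC p) = k^-1 * re p +i* (k^-1 * im p) by case: p.
have k0 : 0 < k := bump_k0 H.
have mX : measurable (itv a b) by exact: measurable_itv.
have mY : measurable (itv c d) by exact: measurable_itv.
have bu := bmeasS measurableT (@subsetT _ (itv a b)) (bump_bmeas H).
have bv := bmeasS measurableT (@subsetT _ (itv c d)) (bump_bmeas H').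
have bf : bmeas (itv a b) f by exact: bmeas_primitive (ltW ab) bu.
have bg : bmeas (itv c d) g by exact: bmeas_primitive (ltW cd) bv.
have bre : bmeas V (fun p : T => u p.1 * g p.2).
  by rewrite /V rectE; exact: bmeasM (bmeas_fst mX mY bu) (bmeas_snd mX mY bg).
have bim : bmeas V (fun p : T => f p.1 * v p.2).
  by rewrite /V rectE; exact: bmeasM (bmeas_fst mX mY bf) (bmeas_snd mX mY bv).
have restr h : bmeas V h -> bmeas setT (h \_ V).
  move=> [mh [M hM]]; split; first exact: (iffLR (measurable_restrictT h mV)).
  exists `|M| => p _; rewrite patchE.
  case: ifPn => [/set_mem /hM|_]; last by rewrite normr0.
  by move=> /le_trans; apply; exact: ler_norm.
have suppE p : eta (toC p) != 0 -> V p /\ (K p.1 \/ L p.2).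
  rewrite etaE /re /im !patchE; case: ifPn => [/set_mem Vp|_]; last by rewrite mulr0 eqxx.
  move=> e0; split => //; apply: contrapT => /not_orP[nK nL].
  have ux : u p.1 = 0 by apply/eqP; apply: contrapT => /negP/(bump_supp H)[].
  have vx : v p.2 = 0 by apply/eqP; apply: contrapT => /negP/(bump_supp H')[].
  by move: e0; rewrite ux vx mul0r !mulr0 eqxx.
exists eta; split.
- by move=> p /suppE[].
- move=> a1 b1 c1 d1 ab1 cd1.
  have [a2 [b2 [h1 h2 h3 hK]]] := bump_thin H ab1.
  have [c2 [d2 [h4 h5 h6 hL]]] := bump_thin H' cd1.
  exists a2, b2, c2, d2; split => //.
    move=> p [/andP[p1 p2] /andP[p3 p4]]; split.
      by rewrite (le_trans h1)//= (le_trans p2).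
    by rewrite (le_trans h4)//= (le_trans p4).
  by move=> p [/hK nK /hL nL] /suppE[_ []].
- split.
    under [X in bmeas _ X]eq_fun do rewrite etaE.
    by apply: bmeasM; [exact: bmeas_cst|exact: restr].
  under [X in bmeas _ X]eq_fun do rewrite etaE.
  by apply: bmeasM; [exact: bmeas_cst|exact: restr].
- have [mA A0 Aab] := bump_block H; have [cm mn nd] := bump_mn H'.
  have mZ : measurable (itv m' n') by exact: measurable_itv.
  exists (A `*` itv m' n'); split.
  + exact: measurableX.
  + rewrite /area product_measure1E//.
    have Z0 : (0 < leb (itv m' n'))%E.
      by rewrite lebesgue_measure_itv/= lte_fin mn -EFinB lte_fin subr_gt0.
    exact: mule_gt0 A0 Z0.
  + move=> [x y] [/= Ax]; rewrite in_itv/= => y1.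
    have [vy gy] := bump_plateau H' y1.
    have ux := bump_uA H Ax.
    have Vp : V (x, y).
      split => /=; first by have := Aab _ Ax; rewrite /= in_itv.
      by move: y1 => /andP[y1 y2]; rewrite (le_trans cm)//= (le_trans y2).
    rewrite etaE /re /im !patchE mem_set//= ux vy /g gy.
    by rewrite mulr1 mulr0 mulr0 mulVf// gt_eqF.
- move=> phi hphi.
  have crV p : V p -> cr_at (fun q => Re (phi (toC q))) (fun q => Im (phi (toC q))) p /\
      cr_at (fun q => - Im (phi (toC q))) (fun q => Re (phi (toC q))) p.
    by move=> Vp; apply/derivable_cr/hphi/VS.
  have W1 := weak_cauchy_riemann (ltW ab) (ltW cd) (fun p Vp => (crV p Vp).1)
    bu bv (bump_int0 H) (bump_int0 H').
  have W2 := weak_cauchy_riemann (ltW ab) (ltW cd) (fun p Vp => (crV p Vp).2)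
    bu bv (bump_int0 H) (bump_int0 H').
  have finV : (area V < +oo)%E.
    rewrite /V rectE /area product_measure1E// lte_mul_pinfty//.
    + by rewrite ge0_fin_numE//; exact: lebesgue_itv_fin.
    + exact: lebesgue_itv_fin.
  have bP : bmeas V (fun p => Re (phi (toC p))).
    rewrite /V rectE; apply: cont_at_rect_bmeas => p /crV[cr1 _].
    by have [] := cr_at_cont cr1.
  have bQ : bmeas V (fun p => Im (phi (toC p))).
    rewrite /V rectE; apply: cont_at_rect_bmeas => p /crV[cr1 _].
    by have [] := cr_at_cont cr1.
  have reduce (F G : T -> R) : bmeas V G -> \int[area]_(p in V) G p = 0 ->
      (forall p, F p = (k^-1 * G p) *+ (p \in V)) ->
      \int[area]_(p in toC @^-1` S) F p = 0.
    move=> bG G0 FG; transitivity (\int[area]_(p in V) (k^-1 * G p)).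
      rewrite Rintegral_mkcond [RHS]Rintegral_mkcond; apply: eq_Rintegral => p _.
      rewrite !patchE FG; case: ifPn => [_|pS].
        by case: ifPn => _; rewrite ?mulr1n ?mulr0n.
      rewrite ifN//; apply: contra pS => /set_mem /VS; exact: mem_set.
    by rewrite RintegralZl ?G0 ?mulr0//; exact: bmeas_integrable bG.
  apply/eqP; rewrite eq_complex; apply/andP; split; apply/eqP => /=.
    apply: reduce W2 _.
      apply: bmeasD; last exact: bmeasM bP bre.
      apply: bmeasM bim; have := bmeasM (bmeas_cst _ (-1)) bQ.
      by apply: eq_bmeas => p _; rewrite mulN1r.
    move=> p; rewrite etaE /re /im !patchE; case: (phi (toC p)) => P Q' /=.
    case: ifPn => _; rewrite ?mulr1n ?mulr0n ?mulr0 ?mul0r ?subrr//=.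
    by rewrite /f /g; ring.
  apply: reduce W1 _.
    by apply: bmeasD; [exact: bmeasM bP bim|exact: bmeasM bQ bre].
  move=> p; rewrite etaE /re /im !patchE; case: (phi (toC p)) => P Q' /=.
  case: ifPn => _; rewrite ?mulr1n ?mulr0n ?mulr0 ?mul0r ?addr0//=.
  by rewrite /f /g; ring.
Qed.

End Frame.

(** * Infinitesimal equivalence classes *)

Section AlmostEverywhere.
Context {R : realType}.
Implicit Types (S : set (plane R)) (P Q : plane R -> Prop).

Lemma ae_onT S P : (forall z, S z -> P z) -> ae_on S P.
Proof. by move=> SP; apply: aeW => p; exact: SP. Qed.

Lemma ae_onS S P Q : (forall z, S z -> P z -> Q z) -> ae_on S P -> ae_on S Q.
Proof. by move=> PQ; rewrite /ae_on; apply: filterS => p SP Sp; apply: PQ (SP Sp). Qed.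

Lemma ae_onS2 S P (P' : plane R -> Prop) Q : (forall z, S z -> P z -> P' z -> Q z) ->
  ae_on S P -> ae_on S P' -> ae_on S Q.
Proof.
move=> PQ; rewrite /ae_on; apply: filterS2 => p SP SP' Sp.
exact: PQ (SP Sp) (SP' Sp).
Qed.

Lemma ae_on_forall S (P : nat -> plane R -> Prop) :
  (forall n, ae_on S (P n)) -> ae_on S (fun z => forall n, P n z).
Proof.
move=> SP; have := ae_foralln SP; rewrite /ae_on.
by apply: filterS => p + Sp n; exact.
Qed.

End AlmostEverywhere.

Section Beltrami.
Context {R : realType}.
Local Notation T := (measurableTypeR R * measurableTypeR R)%type.
Variables (S : set (plane R)) (oS : open S).
Implicit Types (mu nu phi eta : plane R -> plane R).
Local Notation D := (toC @^-1` S : set T).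

Let mD : measurable D. Proof. exact: open_measurable. Qed.

Lemma ess_sup_on_leP E nu (c : R) : 0 <= c ->
  (ess_sup_on E nu <= c%:E)%E <-> ae_on E (fun z => modulus (nu z) <= c).
Proof.
move=> c0; split.
  move=> /ess_supP H; rewrite /ae_on; apply: filterS H => p.
  by rewrite patchE => + Ep; rewrite mem_set.
move=> H; apply/ess_supP; rewrite /ae_on in H; apply: filterS H => p.
rewrite patchE; case: ifPn => [/set_mem Ep /(_ Ep)//|_ _].
by rewrite lee_fin.
Qed.

Lemma area_setT_gt0 : (0 < area [set: T])%E.
Proof.
have -> : [set: T] = setT `*` setT by rewrite setXTT.
rewrite /area product_measure1E//.
have lT : (0 < @lebesgue_measure R setT)%E.
  by rewrite -set_itvNyy lebesgue_measure_itv/= ?ltNyr ?ltry.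
exact: (mule_gt0 lT lT).
Qed.

Lemma ess_sup_on_ge0 E nu : (0 <= ess_sup_on E nu)%E.
Proof.
apply: ess_sup_gee; first exact: area_setT_gt0.
apply: aeW => p; rewrite patchE; case: ifP => // _.
by rewrite lee_fin modulus_ge0.
Qed.

Lemma BelP nu : Bel S nu <->
  measurable_on S nu /\ exists2 M, 0 <= M & ae_on S (fun z => modulus (nu z) <= M).
Proof.
split=> -[mnu].
  have := ess_sup_on_ge0 S nu; case E : (ess_sup_on S nu) => [M| |]//.
  rewrite lee_fin => M0 _; split => //; exists M => //.
  by apply/ess_sup_on_leP => //; rewrite E.
by move=> [M M0 /(ess_sup_on_leP _ _ M0) h]; split => //; rewrite (le_lt_trans h)// ltry.
Qed.

Definition lincomb (s t : R) mu nu : plane R -> plane R :=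
  fun z => s%:C * mu z + t%:C * nu z.

Lemma Re_lincomb s t mu nu z : Re (lincomb s t mu nu z) = s * Re (mu z) + t * Re (nu z).
Proof. by rewrite /lincomb; case: (mu z) (nu z) => [? ?] [? ?] /=; ring. Qed.

Lemma Im_lincomb s t mu nu z : Im (lincomb s t mu nu z) = s * Im (mu z) + t * Im (nu z).
Proof. by rewrite /lincomb; case: (mu z) (nu z) => [? ?] [? ?] /=; ring. Qed.

Lemma measurable_on_lincomb s t mu nu : measurable_on S mu -> measurable_on S nu ->
  measurable_on S (lincomb s t mu nu).
Proof.
move=> [m1 m2] [n1 n2]; split.
  apply: (eq_measurable_fun (fun p => s * Re (mu (toC p)) + t * Re (nu (toC p)))).
    by move=> p _; rewrite -Re_lincomb.
  by apply: measurable_funD; apply: measurable_funM => //; exact: measurable_cst.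
apply: (eq_measurable_fun (fun p => s * Im (mu (toC p)) + t * Im (nu (toC p)))).
  by move=> p _; rewrite -Im_lincomb.
by apply: measurable_funD; apply: measurable_funM => //; exact: measurable_cst.
Qed.

Lemma modulus_lincomb s t mu nu z :
  modulus (lincomb s t mu nu z) <= `|s| * modulus (mu z) + `|t| * modulus (nu z).
Proof. by rewrite (le_trans (modulusD _ _))// !modulusZ. Qed.

Lemma Bel_lincomb s t mu nu : Bel S mu -> Bel S nu -> Bel S (lincomb s t mu nu).
Proof.
move=> /BelP[mmu [M M0 muM]] /BelP[mnu [N N0 nuN]]; apply/BelP; split.
  exact: measurable_on_lincomb.
exists (`|s| * M + `|t| * N); first by rewrite addr_ge0 ?mulr_ge0.
apply: ae_onS2 muM nuN => z _ h1 h2.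
by rewrite (le_trans (modulus_lincomb _ _ _ _ _))// lerD// ler_wpM2l ?h1 ?h2.
Qed.

Lemma ReM (z w : plane R) : Re (z * w) = Re z * Re w - Im z * Im w.
Proof. by case: z w => [? ?] [? ?]. Qed.

Lemma ImM (z w : plane R) : Im (z * w) = Re z * Im w + Im z * Re w.
Proof. by case: z w => [? ?] [? ?]. Qed.

Lemma measurable_onM mu phi : measurable_on S mu -> measurable_on S phi ->
  measurable_on S (fun z => mu z * phi z).
Proof.
move=> [m1 m2] [p1 p2]; split.
  apply: (eq_measurable_fun (fun p => Re (mu (toC p)) * Re (phi (toC p)) -
      Im (mu (toC p)) * Im (phi (toC p)))).
    by move=> p _; rewrite -ReM.
  by apply: measurable_funB; apply: measurable_funM.
apply: (eq_measurable_fun (fun p => Re (mu (toC p)) * Im (phi (toC p)) +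
    Im (mu (toC p)) * Re (phi (toC p)))).
  by move=> p _; rewrite -ImM.
by apply: measurable_funD; apply: measurable_funM.
Qed.

Lemma measurable_modulus mu : measurable_on S mu ->
  measurable_fun D (fun p => modulus (mu (toC p))).
Proof.
move=> [m1 m2].
apply: (eq_measurable_fun (fun p =>
    Num.sqrt (Re (mu (toC p)) ^+ 2 + Im (mu (toC p)) ^+ 2))).
  by move=> p _; rewrite -sqr_modulus sqrtr_sqr ger0_norm ?modulus_ge0.
apply: (measurableT_comp (continuous_measurable_fun (@sqrt_continuous R))).
by apply: measurable_funD; apply: measurable_funX.
Qed.

Lemma Q_measurable phi : Q S phi -> measurable_on S phi.
Proof. by move=> [hphi _]; exact: holomorphic_measurable. Qed.

Lemma Q_integrable phi : Q S phi ->
  area.-integrable D (fun p => (modulus (phi (toC p)))%:E).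
Proof.
move=> Qphi; apply/integrableP; split.
  by apply/measurable_EFinP; apply: measurable_modulus; exact: Q_measurable.
case: Qphi => _; congr (_ < _)%E; apply: eq_integral => p _ /=.
by rewrite ger0_norm ?modulus_ge0.
Qed.

Lemma measurable_Re mu : measurable_on S mu ->
  measurable_fun D (fun p => Re (mu (toC p))).
Proof. by case. Qed.

Lemma measurable_Im mu : measurable_on S mu ->
  measurable_fun D (fun p => Im (mu (toC p))).
Proof. by case. Qed.

Lemma ae_le_integrable (f g : T -> R) : measurable_fun D f -> (forall p, 0 <= g p) ->
  area.-integrable D (EFin \o g) -> (\forall p \ae area, D p -> `|f p| <= g p) ->
  area.-integrable D (EFin \o f).
Proof.
move=> mf g0 /integrableP[mg ig] fg; apply/integrableP; split.
  exact/measurable_EFinP.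
apply: le_lt_trans ig; apply: ae_ge0_le_integral => //.
- by apply: measurableT_comp => //; exact/measurable_EFinP.
- exact: measurableT_comp.
- by apply: filterS fg => p h Dp; rewrite /= lee_fin (ger0_norm (g0 p)) h.
Qed.

Lemma Bel_integrable mu phi : Bel S mu -> Q S phi ->
  area.-integrable D (fun p => (Re (mu (toC p) * phi (toC p)))%:E) /\
  area.-integrable D (fun p => (Im (mu (toC p) * phi (toC p)))%:E).
Proof.
move=> /BelP[mmu [M M0 muM]] Qphi.
have mm := measurable_onM mmu (Q_measurable Qphi).
have Mphi : area.-integrable D (EFin \o (fun p => M * modulus (phi (toC p)))).
  rewrite (_ : _ \o _ = (fun p => M%:E * (modulus (phi (toC p)))%:E)%E)//.
  exact: integrableZl (Q_integrable Qphi).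
have g0 (p : T) : 0 <= M * modulus (phi (toC p)) by rewrite mulr_ge0 ?modulus_ge0.
have h : ae_on S (fun z => modulus (mu z * phi z) <= M * modulus (phi z)).
  by apply: ae_onS muM => z _ h; rewrite modulusM ler_wpM2r ?modulus_ge0.
split; apply: (ae_le_integrable _ g0 Mphi).
- exact: measurable_Re mm.
- apply: (ae_onS (Q := fun z => `|Re (mu z * phi z)| <= M * modulus (phi z)) _ h).
  by move=> z _; apply: le_trans; exact: Re_le_modulus.
- exact: measurable_Im mm.
- apply: (ae_onS (Q := fun z => `|Im (mu z * phi z)| <= M * modulus (phi z)) _ h).
  by move=> z _; apply: le_trans; exact: Im_le_modulus.
Qed.

Lemma cintegral_lincomb s t mu nu phi : Bel S mu -> Bel S nu -> Q S phi ->
  cintegral S (fun z => lincomb s t mu nu z * phi z) =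
  s%:C * cintegral S (fun z => mu z * phi z) + t%:C * cintegral S (fun z => nu z * phi z).
Proof.
move=> Bmu Bnu Qphi.
have [m1 m2] := Bel_integrable Bmu Qphi; have [n1 n2] := Bel_integrable Bnu Qphi.
have lin (f g : T -> R) :
    area.-integrable D (EFin \o f) -> area.-integrable D (EFin \o g) ->
    \int[area]_(p in D) (s * f p + t * g p) =
    s * \int[area]_(p in D) f p + t * \int[area]_(p in D) g p.
  move=> fi gi.
  have Zi r (h : T -> R) : area.-integrable D (EFin \o h) ->
      area.-integrable D (EFin \o (fun p => r * h p)).
    move=> hi; rewrite (_ : _ \o _ = (fun p => r%:E * (h p)%:E)%E)//.
    exact: integrableZl hi.
  rewrite RintegralD ?RintegralZl//; exact: Zi.
rewrite /cintegral; apply/eqP; rewrite eq_complex; apply/andP; split; apply/eqP => /=.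
  rewrite !mul0r !subr0 -lin//; apply: eq_Rintegral => p _.
  by rewrite !ReM Re_lincomb Im_lincomb; ring.
rewrite !mul0r !addr0 -lin//; apply: eq_Rintegral => p _.
by rewrite !ImM Re_lincomb Im_lincomb; ring.
Qed.

Lemma inf_equivalentE mu nu : Bel S mu -> Bel S nu ->
  inf_equivalent S mu nu <-> forall phi, Q S phi ->
    cintegral S (fun z => mu z * phi z) = cintegral S (fun z => nu z * phi z).
Proof.
move=> Bmu Bnu; have m1E : (-1 : R)%:C = -1.
  by apply/eqP; rewrite eq_complex/= oppr0 !eqxx.
have E phi : Q S phi -> cintegral S (fun z => (mu z - nu z) * phi z) =
    cintegral S (fun z => mu z * phi z) - cintegral S (fun z => nu z * phi z).
  move=> Qphi; have := cintegral_lincomb 1 (-1) Bmu Bnu Qphi.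
  rewrite mul1r m1E mulN1r => <-.
  by congr cintegral; apply/funext => z; rewrite /lincomb mul1r m1E mulN1r.
split=> H phi Qphi; first by apply/eqP; rewrite -subr_eq0 -E// H.
by rewrite E// H// subrr.
Qed.

Lemma Zclass_lincomb s t mu f g : Bel S mu -> s + t = 1 ->
  Zclass S mu f -> Zclass S mu g -> Zclass S mu (lincomb s t f g).
Proof.
move=> Bmu st [Bf /inf_equivalentE fmu] [Bg /inf_equivalentE gmu].
have Bfg := Bel_lincomb s t Bf Bg; split => //.
apply/inf_equivalentE => // phi Qphi.
rewrite cintegral_lincomb// -fmu// -gmu// -mulrDl.
by rewrite -(rmorphD (real_complex R)) st mul1r.
Qed.

Lemma Zclass_add_orth t mu f eta : Bel S mu -> Zclass S mu f -> Bel S eta ->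
  (forall phi, Q S phi -> cintegral S (fun z => eta z * phi z) = 0) ->
  Zclass S mu (lincomb 1 t f eta).
Proof.
move=> Bmu [Bf /inf_equivalentE fmu] Be e0.
have Bfg := Bel_lincomb 1 t Bf Be; split => //.
apply/inf_equivalentE => // phi Qphi.
by rewrite cintegral_lincomb// -fmu// e0// mulr0 addr0 mul1r.
Qed.

Lemma modulus_limit_le (u_ : nat -> plane R) (w : plane R) (c : R) (n0 : nat) :
  (fun n => Re (u_ n)) @ \oo --> Re w -> (fun n => Im (u_ n)) @ \oo --> Im w ->
  (forall n, (n0 <= n)%N -> modulus (u_ n) <= c) -> modulus w <= c.
Proof.
move=> /cvgrPdist_lt uRe /cvgrPdist_lt uIm uc; apply/ler_addgt0Pl => e e0.
have e2 : 0 < e / 2 by rewrite divr_gt0.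
have [n1 _ h1] := uRe _ e2; have [n2 _ h2] := uIm _ e2.
pose n := maxn n0 (maxn n1 n2).
have /= l1 := h1 n (leq_trans (leq_maxl _ _) (leq_maxr _ _)).
have /= l2 := h2 n (leq_trans (leq_maxr _ _) (leq_maxr _ _)).
have -> : w = (w - u_ n) + u_ n by rewrite subrK.
rewrite (le_trans (modulusD _ _))// lerD ?uc ?leq_maxl//.
rewrite (le_trans (modulus_le_ReIm _))// [leRHS](splitr e) ltW//.
by case: w (u_ n) l1 l2 {uRe uIm h1 h2} => [? ?] [? ?] /= l1 l2; rewrite ltrD.
Qed.

Lemma Rintegral_dominated_limit (f_ : nat -> T -> R) (f g : T -> R) (c : R) :
  (forall n, measurable_fun D (f_ n)) -> measurable_fun D f ->
  (\forall p \ae area, D p -> f_ ^~ p @ \oo --> f p) ->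
  area.-integrable D (EFin \o g) ->
  (forall n, \forall p \ae area, D p -> `|f_ n p| <= g p) ->
  (forall n, area.-integrable D (EFin \o f_ n)) ->
  (forall n, \int[area]_(p in D) f_ n p = c) -> \int[area]_(p in D) f p = c.
Proof.
move=> mf_ mf ff ig fg if_ fc.
have ff' : \forall p \ae area, D p -> (EFin \o f_ n) p @[n --> \oo] --> (EFin \o f) p.
  apply: filterS ff => p h Dp.
  by apply: cvg_EFin; [exact: nearW|exact: h].
have fg' : \forall p \ae area, forall n, D p -> (`|(EFin \o f_ n) p| <= (EFin \o g) p)%E.
  by have := ae_foralln fg; apply: filterS => p h n Dp; rewrite /= lee_fin h.
have mf_' n : measurable_fun D (EFin \o f_ n) by exact/measurable_EFinP.
have mf' : measurable_fun D (EFin \o f) by exact/measurable_EFinP.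
have [_ _] := dominated_convergence mD mf_' mf' ff' ig fg'.
have fE n : (\int[area]_(p in D) (EFin \o f_ n) p = c%:E)%E.
  have fi := integrable_fin_num mD (if_ n).
  by rewrite -(fc n) /Rintegral fineK.
under eq_fun do rewrite fE.
move=> H; rewrite /Rintegral.
suff -> : (\int[area]_(p in D) (f p)%:E = c%:E)%E by [].
by apply/esym; apply: (cvg_unique _ _ H) => //; exact: cvg_cst.
Qed.

(** A class is closed under bounded convergence almost everywhere, by dominated
    convergence: a multiple of the integrable function [|phi|] is the bound. *)
Lemma Zclass_limit mu (nu_ : nat -> plane R -> plane R) (M : R) : Bel S mu ->
  (forall n, Zclass S mu (nu_ n)) ->
  (forall n, ae_on S (fun z => modulus (nu_ n z) <= M)) ->
  ae_on S (fun z => cvgn (fun n => Re (nu_ n z)) /\ cvgn (fun n => Im (nu_ n z))) ->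
  exists nu, Zclass S mu nu /\ ae_on S (fun z =>
    (fun n => Re (nu_ n z)) @ \oo --> Re (nu z) /\
    (fun n => Im (nu_ n z)) @ \oo --> Im (nu z)).
Proof.
move=> Bmu Znu nuM nucvg.
have [N [mN N0 DN]] := nucvg.
have mNC : measurable (~` N) by exact: measurableC.
(* the sequence is set to 0 on a null set, to converge everywhere *)
pose re n := (fun p => Re (nu_ n (toC p))) \_ (~` N).
pose im n := (fun p => Im (nu_ n (toC p))) \_ (~` N).
have cN p : D p -> ~ N p ->
    cvgn (fun n => Re (nu_ n (toC p))) /\ cvgn (fun n => Im (nu_ n (toC p))).
  by move=> Dp nNp; apply: contrapT => H; apply: nNp; apply: DN => /= /(_ Dp).
have cre p : D p -> cvgn (re ^~ p).
  move=> Dp; rewrite /re; have [pN|/negbTE pN] := boolP (p \in ~` N).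
    under eq_fun do rewrite patchE pN.
    by have [] := cN _ Dp (set_mem pN).
  by under eq_fun do rewrite patchE pN; exact: is_cvg_cst.
have cim p : D p -> cvgn (im ^~ p).
  move=> Dp; rewrite /im; have [pN|/negbTE pN] := boolP (p \in ~` N).
    under eq_fun do rewrite patchE pN.
    by have [] := cN _ Dp (set_mem pN).
  by under eq_fun do rewrite patchE pN; exact: is_cvg_cst.
pose nu (z : plane R) : plane R :=
  limn (re ^~ (Re z, Im z)) +i* limn (im ^~ (Re z, Im z)).
have nuE p : nu (toC p) = limn (re ^~ p) +i* limn (im ^~ p) by case: p.
have mnu : measurable_on S nu.
  split.
    apply: (eq_measurable_fun (fun p => limn (re ^~ p))); first by move=> [].
    apply: (measurable_fun_cvg (h := re)) => // n.
    apply: (iffLR (measurable_restrict _ mNC mD)).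
    exact: measurable_funS mD (@subIsetl _ _ _) (measurable_Re (Znu n).1.1).
  apply: (eq_measurable_fun (fun p => limn (im ^~ p))); first by move=> [].
  apply: (measurable_fun_cvg (h := im)) => // n.
  apply: (iffLR (measurable_restrict _ mNC mD)).
  exact: measurable_funS mD (@subIsetl _ _ _) (measurable_Im (Znu n).1.1).
have nulim : ae_on S (fun z => (fun n => Re (nu_ n z)) @ \oo --> Re (nu z) /\
    (fun n => Im (nu_ n z)) @ \oo --> Im (nu z)).
  exists N; split => // p H; apply: contrapT => nNp; apply: H => Dp.
  have [c1 c2] := cN p Dp nNp; rewrite nuE.
  have reE : re ^~ p = (fun n => Re (nu_ n (toC p))).
    by apply/funext => n; rewrite /re patchE mem_set.
  have imE : im ^~ p = (fun n => Im (nu_ n (toC p))).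
    by apply/funext => n; rewrite /im patchE mem_set.
  by rewrite reE imE; split; [exact: c1|exact: c2].
have nuMM : ae_on S (fun z => modulus (nu z) <= M).
  apply: ae_onS2 nulim (ae_on_forall nuM) => z _ [h1 h2] hM.
  by apply: (modulus_limit_le (n0 := 0) h1 h2).
have nuM' n : ae_on S (fun z => modulus (nu_ n z) <= `|M|).
  by apply: ae_onS (nuM n) => z _ /le_trans; apply; exact: ler_norm.
have Bnu : Bel S nu.
  apply/BelP; split => //; exists `|M| => //.
  by apply: ae_onS nuMM => z _ /le_trans; apply; exact: ler_norm.
exists nu; split => //; split => //; apply/inf_equivalentE => // phi Qphi.
have gi : area.-integrable D (EFin \o (fun p => `|M| * modulus (phi (toC p)))).
  rewrite (_ : _ \o _ = (fun p => `|M|%:E * (modulus (phi (toC p)))%:E)%E)//.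
  exact: integrableZl (Q_integrable Qphi).
have eqn n := (iffLR (inf_equivalentE Bmu (Znu n).1)) (Znu n).2 phi Qphi.
have bnd n : ae_on S (fun z => modulus (nu_ n z * phi z) <= `|M| * modulus (phi z)).
  by apply: ae_onS (nuM' n) => z _ h; rewrite modulusM ler_wpM2r ?modulus_ge0.
apply/eqP; rewrite eq_complex; apply/andP; split; apply/eqP => /=; apply/esym.
  apply: (@Rintegral_dominated_limit
  (fun n p => Re (nu_ n (toC p) * phi (toC p))) _ _ _ _ _ _ gi).
  - by move=> n; exact: (measurable_Re (measurable_onM (Znu n).1.1 (Q_measurable Qphi))).
  - exact: (measurable_Re (measurable_onM mnu (Q_measurable Qphi))).
  - apply: (ae_onS (Q := fun z =>
    (fun n => Re (nu_ n z * phi z)) @ \oo --> Re (nu z * phi z)) _ nulim).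
    move=> z _ [h1 h2]; rewrite ReM; under eq_fun do rewrite ReM.
    by apply: cvgB; apply: cvgM => //; exact: cvg_cst.
  - move=> n; apply: (ae_onS (Q := fun z =>
    `|Re (nu_ n z * phi z)| <= `|M| * modulus (phi z)) _ (bnd n)).
    by move=> z _; apply: le_trans; exact: Re_le_modulus.
  - by move=> n; have [] := Bel_integrable (Znu n).1 Qphi.
  - by move=> n; have := congr1 Re (eqn n) => /= <-.
apply: (@Rintegral_dominated_limit
  (fun n p => Im (nu_ n (toC p) * phi (toC p))) _ _ _ _ _ _ gi).
- by move=> n; exact: (measurable_Im (measurable_onM (Znu n).1.1 (Q_measurable Qphi))).
- exact: (measurable_Im (measurable_onM mnu (Q_measurable Qphi))).
- apply: (ae_onS (Q := fun z =>
    (fun n => Im (nu_ n z * phi z)) @ \oo --> Im (nu z * phi z)) _ nulim).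
  move=> z _ [h1 h2]; rewrite ImM; under eq_fun do rewrite ImM.
  by apply: cvgD; apply: cvgM => //; exact: cvg_cst.
- move=> n; apply: (ae_onS (Q := fun z =>
    `|Im (nu_ n z * phi z)| <= `|M| * modulus (phi z)) _ (bnd n)).
  by move=> z _; apply: le_trans; exact: Im_le_modulus.
- by move=> n; have [] := Bel_integrable (Znu n).1 Qphi.
- by move=> n; have := congr1 Im (eqn n) => /= <-.
Qed.

End Beltrami.

(** * Existence of extremal elements *)

Section Existence.
Context {R : realType}.
Local Notation T := (measurableTypeR R * measurableTypeR R)%type.
Variables (S : set (plane R)) (oS : open S).
Implicit Types (mu nu f g : plane R -> plane R).
Local Notation D := (toC @^-1` S : set T).

Let mD : measurable D. Proof. exact: open_measurable. Qed.

(* a positive integrable weight: area is infinite in general *)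
Let w (p : T) : R := gauss_fun p.1 * gauss_fun p.2.

Let w0 p : 0 < w p. Proof. by rewrite mulr_gt0 ?expR_gt0. Qed.

Let mw : measurable_fun setT w.
Proof.
apply: measurable_funM.
  exact: (measurableT_comp measurable_gauss_fun measurable_fst).
exact: (measurableT_comp measurable_gauss_fun measurable_snd).
Qed.

Let iw : area.-integrable D (EFin \o w).
Proof.
apply: (@integrableS _ _ _ _ setT) => //.
apply/integrableP; split; first exact/measurable_EFinP.
have -> : (\int[area]_p `|(EFin \o w) p| = \int[area]_p (w p)%:E)%E.
  by apply: eq_integral => p _; rewrite /= ger0_norm// ltW.
rewrite /area fubini_tonelli1; last 2 first.
- exact/measurable_EFinP.
- by move=> p; rewrite lee_fin ltW.
rewrite /fubini_F.
pose G := (\int[@lebesgue_measure R]_x (gauss_fun x)%:E)%E.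
have mg : measurable_fun setT (fun x : measurableTypeR R => (gauss_fun x)%:E).
  by apply/measurable_EFinP; exact: measurable_gauss_fun.
have g0 (x : R) : (0 <= (gauss_fun x)%:E)%E by rewrite lee_fin gauss_fun_ge0.
have -> : (fun x : measurableTypeR R => \int[@lebesgue_measure R]_y (w (x, y))%:E)%E =
    (fun x => G * (gauss_fun x)%:E)%E.
  apply/funext => x; rewrite muleC -ge0_integralZl//.
rewrite ge0_integralZl//; last by rewrite integral_ge0.
by rewrite /G !integralT_gauss -EFinM ltry.
Qed.

Definition sqnorm f := \int[area]_(p in D) (w p * modulus (f (toC p)) ^+ 2).

Let msq f : measurable_on S f ->
  measurable_fun D (fun p => w p * modulus (f (toC p)) ^+ 2).
Proof.
move=> mf; apply: measurable_funM; first exact: measurable_funTS.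
by apply: measurable_funX; exact: measurable_modulus.
Qed.

Let sq_ge0 f p : 0 <= w p * modulus (f (toC p)) ^+ 2.
Proof. by rewrite mulr_ge0 ?sqr_ge0// ltW. Qed.

Let isq f : Bel S f ->
  area.-integrable D (EFin \o (fun p => w p * modulus (f (toC p)) ^+ 2)).
Proof.
move=> /BelP[mf [M M0 fM]].
have iMw : area.-integrable D (EFin \o (fun p => M ^+ 2 * w p)).
  rewrite (_ : _ \o _ = (fun p => (M ^+ 2)%:E * (w p)%:E)%E)//; exact: integrableZl iw.
apply: (ae_le_integrable oS (msq mf) _ iMw).
  by move=> p; rewrite mulr_ge0 ?sqr_ge0// ltW.
have H : ae_on S (fun z => modulus (f z) ^+ 2 <= M ^+ 2).
  by apply: ae_onS fM => z _; rewrite ler_sqr// nnegrE modulus_ge0.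
rewrite /ae_on in H; apply: filterS H => p h Dp.
by rewrite ger0_norm// mulrC ler_wpM2r ?h// ltW.
Qed.

Lemma sqnorm_ge0 f : 0 <= sqnorm f. Proof. exact: Rintegral_ge0. Qed.

Lemma sqnorm_parallelogram f g : Bel S f -> Bel S g ->
  sqnorm (lincomb 2^-1 2^-1 f g) + sqnorm (lincomb 2^-1 (- 2^-1) f g) =
  2^-1 * sqnorm f + 2^-1 * sqnorm g.
Proof.
move=> Bf Bg.
have i1 := isq (Bel_lincomb 2^-1 2^-1 Bf Bg).
have i2 := isq (Bel_lincomb 2^-1 (- 2^-1) Bf Bg).
have i3 := isq Bf; have i4 := isq Bg.
have half h : area.-integrable D (EFin \o h) ->
    area.-integrable D (EFin \o (fun p => 2^-1 * h p)).
  move=> ih; rewrite (_ : _ \o _ = (fun p => (2^-1)%:E * (h p)%:E)%E)//.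
  exact: integrableZl ih.
rewrite /sqnorm -RintegralD//.
rewrite -[X in _ = X + _]RintegralZl// -[X in _ = _ + X]RintegralZl//.
rewrite -RintegralD//; [|exact: half|exact: half].
apply: eq_Rintegral => p _; rewrite !sqr_modulus !Re_lincomb !Im_lincomb.
by field.
Qed.

Lemma sqnorm_le f M : 0 <= M -> Bel S f -> ae_on S (fun z => modulus (f z) <= M) ->
  sqnorm f <= M ^+ 2 * \int[area]_(p in D) w p.
Proof.
move=> M0 Bf fM; have i1 := isq Bf; rewrite -RintegralZl//.
have iMw : area.-integrable D (EFin \o (fun p => M ^+ 2 * w p)).
  rewrite (_ : _ \o _ = (fun p => (M ^+ 2)%:E * (w p)%:E)%E)//; exact: integrableZl iw.
rewrite /sqnorm /Rintegral fine_le//;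
  [exact: integrable_fin_num|exact: integrable_fin_num|].
have H : ae_on S (fun z => modulus (f z) ^+ 2 <= M ^+ 2).
  by apply: ae_onS fM => z _; rewrite ler_sqr// nnegrE modulus_ge0.
apply: ae_ge0_le_integral => //.
- by move=> p _; rewrite lee_fin.
- by case/integrableP : i1.
- by move=> p _; rewrite lee_fin mulr_ge0 ?sqr_ge0// ltW.
- by case/integrableP : iMw.
- rewrite /ae_on in H; apply: filterS H => p h Dp.
  by rewrite lee_fin mulrC ler_wpM2r ?h// ltW.
Qed.

Lemma cvg_geometric_steps (x_ : nat -> R) (K : R) :
  (forall n, `|x_ n.+1 - x_ n| <= K * 2^-1 ^+ n) -> cvgn x_.
Proof.
move=> xK.
have c : cvgn (series (telescope x_)).
  apply: normed_cvg; apply: (@series_le_cvg _ _ (geometric K 2^-1)) => //.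
  - by move=> n; exact: normr_ge0.
  - by move=> n; exact: le_trans (xK n).
  - by apply: is_cvg_geometric_series; rewrite ger0_norm// invf_lt1// ltr1n.
have -> : x_ = (fun n => x_ 0%N + series (telescope x_) n).
  by apply/funext => n; exact: eq_sum_telescope.
by apply: is_cvgD => //; exact: is_cvg_cst.
Qed.

(** Convergence in weighted [L^2] at a geometric rate implies convergence almost
    everywhere: the weighted squares of the steps, multiplied by [4 ^+ n], have
    summable integrals, so that their sum is finite almost everywhere and the
    steps themselves decrease like [2^-1 ^+ n]. *)
Lemma sqnorm_steps_cvg (f_ : nat -> plane R -> plane R) :
  (forall n, Bel S (f_ n)) ->
  (forall n, sqnorm (lincomb 2^-1 (- 2^-1) (f_ n) (f_ n.+1)) <= 2 * 8^-1 ^+ n) ->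
  ae_on S (fun z => cvgn (fun n => Re (f_ n z)) /\ cvgn (fun n => Im (f_ n z))).
Proof.
move=> Bf fd.
pose g n := lincomb 2^-1 (- 2^-1) (f_ n) (f_ n.+1).
have Bg n : Bel S (g n) by exact: Bel_lincomb.
pose h n p := (4 ^+ n * (w p * modulus (g n (toC p)) ^+ 2))%:E.
have mh n : measurable_fun D (h n).
  apply/measurable_EFinP; apply: measurable_funM; first exact: measurable_cst.
  by apply: msq; case/BelP : (Bg n).
have h0 n p : D p -> (0 <= h n p)%E by move=> _; rewrite lee_fin mulr_ge0// exprn_ge0.
have hint n : (\int[area]_(p in D) h n p <= (4 / (2 ^ n.+1)%:R)%:E)%E.
  rewrite /h; under eq_integral do rewrite EFinM.
  have ig := isq (Bg n).
  rewrite integralZl//.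
  rewrite -(fineK (integrable_fin_num _ ig))// -EFinM lee_fin.
  apply: (@le_trans _ _ (4 ^+ n * (2 * 8^-1 ^+ n))).
    by rewrite ler_wpM2l ?exprn_ge0//; exact: fd.
  rewrite natrX exprS mulrCA -exprMn.
  have -> : (4 * 8^-1 : R) = 2^-1 by field.
  rewrite exprVn le_eqVlt; apply/orP; left; apply/eqP.
  have : (2 : R) ^+ n != 0 by rewrite expf_neq0.
  by move=> ?; field.
pose H p := (\sum_(0 <= n <oo) h n p)%E.
have Hi : area.-integrable D H.
  apply/integrableP; split.
    by apply: ge0_emeasurable_sum => // n p Dp _; exact: h0.
  have -> : (\int[area]_(p in D) `|H p| = \int[area]_(p in D) H p)%E.
    apply: eq_integral => p /set_mem Dp; rewrite gee0_abs//.
    by apply: nneseries_ge0 => n _ _; exact: h0.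
  rewrite integral_nneseries//.
  apply: (@le_lt_trans _ _ (\sum_(0 <= n <oo) (4 / (2 ^ n.+1)%:R)%:E)%E).
    apply: lee_nneseries => [n _ _|n _]; last exact: hint.
    by apply: integral_ge0 => p; exact: h0.
  by rewrite (le_lt_trans (epsilon_trick0 _ _))// ltry.
have : ae_on S (fun z => exists K, forall n, modulus (g n z) <= K * 2^-1 ^+ n).
  have := integrable_ae mD Hi; rewrite /ae_on; apply: filterS => p Hp Dp.
  have {Hp}Hp := Hp Dp.
  have H0 : (0 <= H p)%E by apply: nneseries_ge0 => n _ _; exact: h0.
  pose C := fine (H p).
  have C0 : 0 <= C by exact: fine_ge0.
  exists (Num.sqrt (C / w p)) => n.
  have hn : (h n p <= C%:E)%E.
    rewrite /C fineK//.
    have := @nneseries_lim_ge _ (h ^~ p) xpredT 0%N n.+1 (fun k _ _ => h0 k p Dp).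
    apply: le_trans; rewrite big_nat_recr//= leeDr//.
    by apply: sume_ge0 => k _; exact: h0.
  rewrite lee_fin in hn.
  have K0 : 0 <= Num.sqrt (C / w p) * 2^-1 ^+ n.
    by rewrite mulr_ge0 ?sqrtr_ge0// exprn_ge0.
  rewrite -ler_sqr ?nnegrE ?modulus_ge0// exprMn sqr_sqrtr; last first.
    by rewrite divr_ge0// ltW.
  have -> : (2^-1 ^+ n) ^+ 2 = (4 ^+ n)^-1 :> R.
    by rewrite -exprM mulnC exprM exprVn -natrX exprVn.
  have t0 : 0 < w p * 4 ^+ n by apply: mulr_gt0; [exact: w0|exact: exprn_gt0].
  rewrite -mulrA -invfM ler_pdivlMr//.
  by apply: le_trans hn; rewrite le_eqVlt; apply/orP; left; apply/eqP; ring.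
move=> gbnd; apply: ae_onS gbnd => z _ [K gK].
have gE n : f_ n.+1 z - f_ n z = - (2%:C * g n z).
  rewrite /g /lincomb; case: (f_ n z) (f_ n.+1 z) => [? ?] [? ?].
  by apply/eqP; rewrite eq_complex/=; apply/andP; split; apply/eqP; field.
split; apply: (@cvg_geometric_steps _ (2 * K)) => n.
  rewrite -mulrA (_ : _ - _ = Re (f_ n.+1 z - f_ n z)); last first.
    by case: (f_ n.+1 z) (f_ n z) => [? ?] [? ?].
  rewrite gE (le_trans (Re_le_modulus _))// modulusN modulusZ ger0_norm// ler_wpM2l//.
rewrite -mulrA (_ : _ - _ = Im (f_ n.+1 z - f_ n z)); last first.
  by case: (f_ n.+1 z) (f_ n z) => [? ?] [? ?].
rewrite gE (le_trans (Im_le_modulus _))// modulusN modulusZ ger0_norm// ler_wpM2l//.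
Qed.

End Existence.

Section Extremal.
Context {R : realType}.
Local Notation T := (measurableTypeR R * measurableTypeR R)%type.
Variables (S : set (plane R)) (oS : open S).
Implicit Types (mu nu f g : plane R -> plane R).

Lemma Zclass_refl mu : Bel S mu -> Zclass S mu mu.
Proof. by move=> Bmu; split => //; apply/(inf_equivalentE oS). Qed.

Lemma ZnormP mu : Bel S mu -> exists2 k : R, 0 <= k & Znorm S mu = k%:E.
Proof.
move=> Bmu.
have Z0 : (0 <= Znorm S mu)%E.
  by apply: le_ereal_inf_tmp => _ [nu _ <-]; exact: ess_sup_on_ge0.
have Zoo : (Znorm S mu < +oo)%E.
  apply: (le_lt_trans _ Bmu.2); apply: ereal_inf_lbound.
  by exists mu => //; exact: Zclass_refl.
by case: (Znorm S mu) Z0 Zoo => // k; rewrite lee_fin => k0 _; exists k.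
Qed.

Lemma extremalP mu (k : R) nu : 0 <= k -> Znorm S mu = k%:E ->
  extremal S mu nu <-> Zclass S mu nu /\ ae_on S (fun z => modulus (nu z) <= k).
Proof.
move=> k0 Zk; split => -[Znu H]; split => //.
  by apply/ess_sup_on_leP => //; rewrite H Zk.
apply/eqP; rewrite eq_le; apply/andP; split; first by rewrite Zk; apply/ess_sup_on_leP.
by apply: ereal_inf_lbound; exists nu.
Qed.

(** The elements [C n] of the class whose sup norm is at most [1 / (n + 1)] above
    the infimum form a decreasing sequence of convex sets. Elements of [C n] of
    nearly minimal weighted [L^2] norm form a Cauchy sequence, by the
    parallelogram law, and its limit attains the infimum. *)
Lemma exists_extremal mu : Bel S mu -> extremal S mu !=set0.
Proof.
move=> Bmu; have [k k0 Zk] := ZnormP Bmu.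
pose C n f := Zclass S mu f /\ ae_on S (fun z => modulus (f z) <= k + n.+1%:R^-1).
have inv0 n : 0 < n.+1%:R^-1 :> R by rewrite invr_gt0.
have inv_le m n : (m <= n)%N -> n.+1%:R^-1 <= m.+1%:R^-1 :> R.
  by move=> mn; rewrite lef_pV2 ?posrE// ler_nat.
have Cmono m n f : (m <= n)%N -> C n f -> C m f.
  move=> mn [Zf fn]; split => //; apply: ae_onS fn => z _ /le_trans; apply.
  by rewrite lerD2l inv_le.
have Cne n : exists f, C n f.
  have : (Znorm S mu < (k + n.+1%:R^-1)%:E)%E by rewrite Zk lte_fin ltrDl.
  move=> /ereal_inf_lt[_ [f Zf <-]] /ltW H; exists f; split => //.
  by apply/ess_sup_on_leP; rewrite // addr_ge0// ltW.
pose N := sqnorm S.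
pose d n := inf (N @` C n).
have has n : has_inf (N @` C n).
  split; first by have [f Cf] := Cne n; exists (N f), f.
  by exists 0 => _ [f _ <-]; exact: sqnorm_ge0.
have d_le n f : C n f -> d n <= N f.
  by move=> Cf; apply: ge_inf; [case: (has n)|exists f].
have d_mono m n : (m <= n)%N -> d m <= d n.
  move=> mn; apply: lb_le_inf; first by case: (has n).
  by move=> _ [f Cf <-]; apply: d_le; exact: Cmono Cf.
pose B := (k + 1) ^+ 2 *
  \int[area]_(p in toC @^-1` S : set T) (gauss_fun p.1 * gauss_fun p.2).
have d_ub n : d n <= B.
  have [f Cf] := Cne n; apply: (le_trans (d_le n f Cf)).
  have [[Bf _] fk] := Cf.
  apply: sqnorm_le => //; first by rewrite addr_ge0.
  apply: ae_onS fk => z _ /le_trans; apply; rewrite lerD2l.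
  by rewrite invf_le1 ?ler1n.
have hs : has_sup (range d).
  by split; [exists (d 0%N), 0%N|exists B => _ [n _ <-]].
pose dd := sup (range d).
have d_dd n : d n <= dd by apply: ub_le_sup; [case: hs|exists n].
have e0 j : 0 < (8^-1 : R) ^+ j by rewrite exprn_gt0.
have pick j : exists nf : nat * (plane R -> plane R),
    [/\ (j <= nf.1)%N, dd - 8^-1 ^+ j <= d nf.1, C nf.1 nf.2 & N nf.2 <= dd + 8^-1 ^+ j].
  have [_ [n _ <-] nd] := sup_adherent (e0 j) hs.
  pose m := maxn j n.
  have [_ [f Cf <-] fd] := inf_adherent (e0 j) (has m).
  exists (m, f); split => //=; first exact: leq_maxl.
    by rewrite (le_trans (ltW nd))// d_mono// leq_maxr.
  by rewrite (le_trans (ltW fd))// lerD2r d_dd.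
have [nf nfP] := choice pick.
pose f_ j := (nf j).2; pose n_ j := (nf j).1.
have n_le j : (j <= n_ j)%N by case: (nfP j).
have n_d j : dd - 8^-1 ^+ j <= d (n_ j) by case: (nfP j).
have Cf j : C (n_ j) (f_ j) by case: (nfP j).
have Nf j : N (f_ j) <= dd + 8^-1 ^+ j by case: (nfP j).
have Bf j : Bel S (f_ j) by case: (Cf j) => -[].
have e_le j : (8^-1 : R) ^+ j.+1 <= 8^-1 ^+ j.
  by rewrite exprS ler_piMl ?ltW// invf_lt1// ltr1n.
have steps j : N (lincomb 2^-1 (- 2^-1) (f_ j) (f_ j.+1)) <= 2 * 8^-1 ^+ j.
  pose m := minn (n_ j) (n_ j.+1).
  have [Z1 b1] : C m (f_ j) by apply: Cmono (Cf j); exact: geq_minl.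
  have [Z2 b2] : C m (f_ j.+1) by apply: Cmono (Cf j.+1); exact: geq_minr.
  have half : 2^-1 + 2^-1 = 1 :> R by field.
  have Cm : C m (lincomb 2^-1 2^-1 (f_ j) (f_ j.+1)).
    split; first exact: Zclass_lincomb.
    apply: ae_onS2 b1 b2 => z _ h1 h2.
    rewrite (le_trans (modulus_lincomb _ _ _ _ _))// !ger0_norm//.
    by rewrite -mulrDr ler_pdivrMl// mulr_natl mulr2n lerD.
  have dm : dd - 8^-1 ^+ j <= d m.
    rewrite /m; case: leqP => _; first exact: n_d.
    by rewrite (le_trans _ (n_d j.+1))// lerB.
  have := sqnorm_parallelogram oS (Bf j) (Bf j.+1).
  have := d_le _ _ Cm; have := Nf j; have := Nf j.+1; have := e_le j.
  rewrite -!/(N _); lra.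
have cf := sqnorm_steps_cvg oS Bf steps.
have fk1 n : ae_on S (fun z => modulus (f_ n z) <= k + 1).
  have [_ fk] := Cf n; apply: ae_onS fk => z _ /le_trans; apply; rewrite lerD2l.
  by rewrite invf_le1 ?ler1n.
have [nu [Znu nulim]] := Zclass_limit oS Bmu (fun n => (Cf n).1) fk1 cf.
exists nu; apply/(extremalP nu k0 Zk); split => //.
have fn := ae_on_forall (fun n => (Cf n).2).
apply: ae_onS2 nulim fn => z _ [c1 c2] fz.
apply/ler_addgt0Pr => e ep.
have [n ne] : exists n, n.+1%:R^-1 < e :> R.
  have [n _ /(_ n (leqnn n))] := near_infty_natSinv_lt (PosNum ep).
  by exists n.
apply: (@modulus_limit_le R (fun n => f_ n z) (nu z) (k + e) n c1 c2) => m nm.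
rewrite (le_trans (fz m))// lerD2l (le_trans _ (ltW ne))// inv_le//.
exact: leq_trans (n_le m).
Qed.

End Extremal.

(** * Tools for modifying extremal elements *)

Section Extremals.
Context {R : realType}.
Local Notation T := (measurableTypeR R * measurableTypeR R)%type.
Variables (S : set (plane R)) (oS : open S).
Implicit Types (mu nu eta : plane R -> plane R).

Lemma ae_on_exists (A : set T) (P : plane R -> Prop) : measurable A -> (0 < area A)%E ->
  A `<=` toC @^-1` S -> ae_on S P -> exists2 p, A p & P (toC p).
Proof.
move=> mA A0 AS [N [mN N0 HN]]; apply: contrapT => H.
move: A0; rewrite ltNge => /negP; apply; rewrite -N0.
apply: le_measure; rewrite ?inE//; move=> p Ap; apply: HN => /= SP.
by apply: H; exists p => //; apply/SP/AS.
Qed.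

Lemma nonempty_open_area (U : set (plane R)) : open U -> U !=set0 ->
  (0 < area (toC @^-1` U : set T))%E.
Proof.
move=> oU [z Uz].
have Up : (toC @^-1` U) (Re z, Im z) by rewrite /preimage/= toC_ReIm.
have [q [/andP[q1 q2] _ qU]] := box_open_qrect (open_box oU) Up.
have V0 : (0 < area (qrect q : set T))%E.
  rewrite /qrect rectE /area product_measure1E//; try exact: measurable_itv.
  have pos (a b : R) : a < b -> (0 < @lebesgue_measure R `[a, b])%E.
    by move=> ab; rewrite lebesgue_measure_itv/= lte_fin ab -EFinB lte_fin subr_gt0.
  by apply: mule_gt0; apply: pos; rewrite ltr_rat.
apply: (lt_le_trans V0); apply: le_measure => //; rewrite inE.
- exact: measurable_rect.
- exact: open_measurable.
Qed.

(** Strict convexity of the disc: the squared modulus of the combination is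
    [(1 - t) |z|^2 + t |w|^2 - t (1 - t) |z - w|^2]. *)
Lemma disc_strictly_convex (t k : R) (z w : plane R) : 0 < t < 1 ->
  modulus z <= k -> modulus w <= k ->
  modulus ((1 - t)%:C * z + t%:C * w) = k -> z = w.
Proof.
move=> /andP[t0 t1] zk wk Ek.
have k0 : 0 <= k by rewrite (le_trans _ zk) ?modulus_ge0.
have zk2 : modulus z ^+ 2 <= k ^+ 2 by rewrite ler_sqr// nnegrE modulus_ge0.
have wk2 : modulus w ^+ 2 <= k ^+ 2 by rewrite ler_sqr// nnegrE modulus_ge0.
have E : modulus ((1 - t)%:C * z + t%:C * w) ^+ 2 =
    (1 - t) * modulus z ^+ 2 + t * modulus w ^+ 2 - t * (1 - t) * modulus (z - w) ^+ 2.
  by rewrite !sqr_modulus; case: z w {zk wk Ek zk2 wk2} => [? ?] [? ?] /=; ring.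
rewrite Ek in E.
have tt : 0 < t * (1 - t) by rewrite mulr_gt0// subr_gt0.
have h1 : (1 - t) * modulus z ^+ 2 <= (1 - t) * k ^+ 2.
  by rewrite ler_wpM2l// subr_ge0 ltW.
have h2 : t * modulus w ^+ 2 <= t * k ^+ 2 by rewrite ler_wpM2l// ltW.
have h3 : t * (1 - t) * modulus (z - w) ^+ 2 <= 0 by lra.
rewrite pmulr_rle0// in h3.
have /eqP : modulus (z - w) ^+ 2 = 0 by apply/eqP; rewrite eq_le h3 sqr_ge0.
by rewrite sqrf_eq0 => /eqP/modulus_eq0/eqP; rewrite subr_eq0 => /eqP.
Qed.

Lemma annihilator_bound (V : set T) eta : annihilator S V eta ->
  exists2 M, 0 < M & forall z, modulus (eta z) <= M.
Proof.
move=> H; have [[_ [M1 h1]] [_ [M2 h2]]] := ann_bmeas H.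
exists (`|M1| + `|M2| + 1); first by rewrite ltr_wpDl// addr_ge0.
move=> z; rewrite -(toC_ReIm z) (le_trans (modulus_le_ReIm _))// -addrA lerD//.
  by rewrite (le_trans (h1 _ _))// ler_norm.
by rewrite (le_trans (h2 _ _))// (le_trans (ler_norm _))// lerDl.
Qed.

Lemma annihilator_Bel (V : set T) eta : annihilator S V eta -> Bel S eta.
Proof.
move=> H; have [[m1 _] [m2 _]] := ann_bmeas H; have [M M0 hM] := annihilator_bound H.
apply/BelP; split; first by split; exact: measurable_funTS.
by exists M; [exact: ltW|exact: ae_onT].
Qed.

(** The largest multiple of an annihilator that can be added within the bound
    [k] makes this bound sharp on the support, for otherwise there would be
    room for more. A largest one exists because the annihilator is 1 on its
    block, where a multiple above [2 k] would break the bound. *)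
Lemma sharp_coefficient (V : set T) nu eta (k : R) : annihilator S V eta ->
  V `<=` toC @^-1` S -> ae_on S (fun z => modulus (nu z) <= k) ->
  exists t : R,
    ae_on S (fun z => eta z != 0 -> modulus (lincomb 1 t nu eta z) <= k) /\
    forall c, c < k ->
      ~ ae_on S (fun z => eta z != 0 -> modulus (lincomb 1 t nu eta z) <= c).
Proof.
move=> H VS nuk; have [M M0 etaM] := annihilator_bound H.
have [P [mP P0 Peta]] := ann_block H.
have lincombD s t z : lincomb 1 (s + t) nu eta z = lincomb 1 s nu eta z + t%:C * eta z.
  rewrite /lincomb; case: (nu z) (eta z) => [? ?] [? ?].
  by apply/eqP; rewrite eq_complex /=; apply/andP; split; apply/eqP; ring.
pose A := [set t : R |
  ae_on S (fun z => eta z != 0 -> modulus (lincomb 1 t nu eta z) <= k)].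
have A0 : A 0.
  by apply: ae_onS nuk => z _ h _; rewrite /lincomb mul1r mul0r addr0.
have Aub t : A t -> t <= k + k.
  move=> At; have PS : P `<=` toC @^-1` S.
    by move=> p Pp; apply/VS/(ann_supp H); rewrite Peta// oner_neq0.
  have both : ae_on S (fun z => (eta z != 0 ->
      modulus (lincomb 1 t nu eta z) <= k) /\ modulus (nu z) <= k).
    exact: ae_onS2 At nuk.
  have [p Pp [h1 h2]] := ae_on_exists mP P0 PS both.
  have := h1 _; rewrite /lincomb Peta// oner_neq0 mul1r mulr1 => /(_ isT) h3.
  apply: (le_trans (ler_norm t)); rewrite -modulus_real.
  have -> : t%:C = (nu (toC p) + t%:C) + (- nu (toC p)) by rewrite addrAC subrr add0r.
  by rewrite (le_trans (modulusD _ _))// modulusN lerD.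
have hs : has_sup A by split; [exists 0|exists (k + k) => t; exact: Aub].
have step s t z : modulus (lincomb 1 (s + t) nu eta z) <=
    modulus (lincomb 1 s nu eta z) + `|t| * M.
  by rewrite lincombD (le_trans (modulusD _ _))// lerD2l modulusZ ler_wpM2l.
exists (sup A); split.
  have Hn n : ae_on S (fun z => eta z != 0 ->
      modulus (lincomb 1 (sup A) nu eta z) <= k + n.+1%:R^-1 * M).
    have n0 : 0 < n.+1%:R^-1 :> R by rewrite invr_gt0.
    have [t At tA] := sup_adherent n0 hs.
    have tsup : t <= sup A := ub_le_sup hs.2 At.
    apply: ae_onS At => z _ h ez; have := step t (sup A - t) z.
    rewrite subrKC => /le_trans; apply.
    rewrite lerD ?h// ler_wpM2r ?(ltW M0)// ger0_norm ?subr_ge0//.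
    by rewrite lerBlDr -lerBlDl ltW.
  apply: ae_onS (ae_on_forall Hn) => z _ h ez; apply/ler_addgt0Pr => e e0.
  have [n ne] : exists n, n.+1%:R^-1 < e / M :> R.
    have [n _ /(_ n (leqnn n))] := near_infty_natSinv_lt (PosNum (divr_gt0 e0 M0)).
    by exists n.
  by rewrite (le_trans (h n ez))// lerD2l -ler_pdivlMr// ltW.
move=> c ck Hc.
have As : A (sup A + (k - c) / M).
  apply: ae_onS Hc => z _ h ez; rewrite (le_trans (step _ _ _))//.
  rewrite ger0_norm; last by rewrite divr_ge0 ?subr_ge0 ?(ltW ck) ?(ltW M0).
  by rewrite divfK ?gt_eqF//; have := h ez; lra.
have : sup A + (k - c) / M <= sup A := ub_le_sup hs.2 As.
by rewrite gerDl leNgt divr_gt0// subr_gt0.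
Qed.

Lemma infinite_classes (P : set (plane R -> plane R)) (f : nat -> plane R -> plane R) :
  (forall n, P (f n)) -> (forall n, Bel S (f n)) ->
  (forall m n, ae_on S (fun z => f m z = f n z) -> m = n) ->
  infinite_set (ae_class S @` P).
Proof.
move=> Pf Bf fI.
have inj : {in [set: nat] &, injective (fun n => ae_class S (f n))}.
  move=> m n _ _ mn; apply: fI.
  have : ae_class S (f m) (f m) by split => //; exact: ae_onT.
  by rewrite mn => -[].
move=> fin; apply: infinite_nat.
rewrite -(eq_finite_set (inj_card_eq inj)).
by apply: sub_finite_set fin => _ [n _ <-]; exists (f n).
Qed.

End Extremals.

Section Superposition.
Context {R : realType}.
Local Notation T := (measurableTypeR R * measurableTypeR R)%type.
Variables (S : set (plane R)) (oS : open S).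
Implicit Types (mu nu : plane R -> plane R) (eta : nat -> plane R -> plane R).

Definition box (V : set T) := exists a b c d, [/\ a < b, c < d & V = rect a b c d].

(** Box 0 is reserved for a perturbation inside [E]; the other boxes are to carry
    the points where the modulus is nearly maximal. *)
Lemma exists_boxes (E : set (plane R)) : open E -> E !=set0 -> E `<=` S ->
  exists V : nat -> set T, [/\ forall n, box (V n), V 0%N `<=` toC @^-1` E,
    forall n, V n `<=` toC @^-1` S &
    forall U : set (plane R), open U -> U !=set0 -> U `<=` S ->
      exists n, V n.+1 `<=` toC @^-1` U].
Proof.
move=> oE E0 ES.
have find (U : set (plane R)) : open U -> U !=set0 ->
    exists q, proper_qrect q /\ qrect q `<=` toC @^-1` U.
  move=> oU [z Uz]; have Up : (toC @^-1` U) (Re z, Im z) by rewrite /preimage/= toC_ReIm.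
  by have [q [q1 _ q2]] := box_open_qrect (open_box oU) Up; exists q.
have [q0 [q0p q0E]] := find E oE E0.
pose ok q := proper_qrect q /\ @qrect R q `<=` toC @^-1` S.
have ok0 : ok q0 by split => // p /q0E; exact: ES.
pose Q n := if unpickle n is Some q then (if `[< ok q >] then q else q0) else q0.
have okQ n : ok (Q n).
  by rewrite /Q; case: unpickle => // q; case: asboolP.
pose V n : set T := if n is m.+1 then qrect (Q m) else qrect q0.
have boxq q : proper_qrect q -> box (qrect q).
  move=> /andP[h1 h2]; exists (ratr q.1.1), (ratr q.1.2), (ratr q.2.1), (ratr q.2.2).
  by split; rewrite ?ltr_rat.
exists V; split => //.
- by case=> [|n]; apply: boxq => //; case: (okQ n).
- by case=> [|n]; [case: ok0|case: (okQ n)].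
- move=> U oU U0 US; have [q [qp qU]] := find U oU U0.
  exists (pickle q); rewrite /V /Q pickleK.
  by case: asboolP => // nok; exfalso; apply: nok; split => // p /qU; exact: US.
Qed.

(** As finitely many thin supports never fill a box, the supports can be chosen
    disjoint one after the other, whatever the overlaps of the boxes. *)
Lemma disjoint_annihilators (V : nat -> set T) : (forall n, box (V n)) ->
  (forall n, V n `<=` toC @^-1` S) ->
  exists eta, (forall n, annihilator S (V n) (eta n)) /\
    (forall m n z, eta m z != 0 -> eta n z != 0 -> m = n).
Proof.
move=> Vbox VS.
have next (nA : nat * set T) : exists e : plane R -> plane R, thin nA.2 ->
    annihilator S (V nA.1) e /\ forall p, nA.2 p -> e (toC p) = 0.
  case: nA => n A /=; have [tA|] := pselect (thin A); last by exists (fun=> 0).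
  have [a [b [c [d [ab cd VE]]]]] := Vbox n.
  have [a' [b' [c' [d' [ab' cd' sub disj]]]]] := tA a b c d ab cd.
  have subV : rect a' b' c' d' `<=` V n by rewrite VE.
  have [e He] := exists_annihilator oS ab' cd' (subset_trans subV (VS n)).
  exists e => _; split.
    case: He => h1 h2 h3 h4 h5; split => //.
    by move=> p /h1/subV.
  move=> p Ap; apply/eqP; apply: contrapT => /negP/(ann_supp He)/disj; exact.
have [nx nxP] := choice next.
pose supp (e : plane R -> plane R) := [set p : T | e (toC p) != 0].
pose A := fix A n : set T := if n is m.+1 then A m `|` supp (nx (m, A m)) else set0.
have tA n : thin (A n).
  elim: n => [|n ih] /=; first exact: thin0.
  by apply: thinU => //; have [/ann_thin] := nxP (n, A n) ih.
pose eta n := nx (n, A n).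
have etaP n := nxP (n, A n) (tA n).
have AS m n : (m < n)%N -> supp (eta m) `<=` A n.
  elim: n => // n ih; rewrite ltnS leq_eqVlt => /predU1P[->|/ih sub] p.
    by right.
  by move=> /sub; left.
exists eta; split; first by move=> n; case: (etaP n).
have lt m n z : eta m z != 0 -> eta n z != 0 -> ~ (m < n)%N.
  move=> em en mn; move: (en); have [_] := etaP n.
  move=> /(_ (Re z, Im z)) /=; rewrite -/(eta n) toC_ReIm => ->; first by rewrite eqxx.
  by apply: (AS m n mn); rewrite /supp/= toC_ReIm.
move=> m n z em en; case: (ltngtP m n) => // mn; first by have := lt _ _ _ em en.
by have := lt _ _ _ en em.
Qed.

(** The supports being disjoint, the partial sums change at most once at every
    point; so they converge, and they satisfy the bound [k] since each term
    separately does. *)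
Lemma superposition mu nu eta (c : nat -> R) (k : R) : Bel S mu -> Zclass S mu nu ->
  (forall n, Bel S (eta n)) ->
  (forall n phi, Q S phi -> cintegral S (fun z => eta n z * phi z) = 0) ->
  (forall m n z, eta m z != 0 -> eta n z != 0 -> m = n) ->
  ae_on S (fun z => modulus (nu z) <= k) ->
  (forall n, ae_on S (fun z => eta n z != 0 ->
    modulus (lincomb 1 (c n) nu (eta n) z) <= k)) ->
  exists nu', [/\ Zclass S mu nu', ae_on S (fun z => modulus (nu' z) <= k) &
    forall n, ae_on S (fun z => eta n z != 0 ->
      nu' z = lincomb 1 (c n) nu (eta n) z)].
Proof.
move=> Bmu Znu Beta orth disj nuk etak.
pose s := fix s n := if n is m.+1 then lincomb 1 (c m) (s m) (eta m) else nu.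
have Zs n : Zclass S mu (s n).
  by elim: n => [//|n ih] /=; apply: Zclass_add_orth => //; exact: orth.
have s_off n z : (forall m, (m < n)%N -> eta m z = 0) -> s n z = nu z.
  elim: n => [//|n ih] H /=; rewrite /lincomb H// mulr0 addr0 mul1r.
  by apply: ih => m mn; apply: H; exact: ltnW.
have eta0 m n z : eta m z != 0 -> n != m -> eta n z = 0.
  move=> em nm; apply/eqP; apply: contrapT => /negP en.
  by move: nm; rewrite (disj _ _ _ en em) eqxx.
have s_on m n z : eta m z != 0 -> (m < n)%N -> s n z = lincomb 1 (c m) nu (eta m) z.
  move=> em; elim: n => // n ih; rewrite ltnS leq_eqVlt => /predU1P[<-|mn] /=.
    rewrite {1}/lincomb s_off// => i im; apply: (eta0 m) => //.
    by rewrite ltn_eqF.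
  by rewrite /lincomb (eta0 m n)// ?gtn_eqF// mulr0 addr0 mul1r ih.
have s_fin n z : s n z = nu z \/
    exists2 m, eta m z != 0 & s n z = lincomb 1 (c m) nu (eta m) z.
  have [[m em]|none] := pselect (exists m, eta m z != 0).
    have [mn|nm] := ltnP m n; first by right; exists m => //; exact: s_on.
    left; apply: s_off => i im; apply: (eta0 m) => //.
    by rewrite ltn_eqF// (leq_trans im).
  left; apply: s_off => i _; apply/eqP; apply: contrapT => /negP ei.
  by apply: none; exists i.
have sk n : ae_on S (fun z => modulus (s n z) <= k).
  apply: ae_onS2 nuk (ae_on_forall etak) => z _ nz ez.
  by case: (s_fin n z) => [->//|[m em ->]]; exact: ez.
have eventually_cst z : exists w, exists n0, forall n, (n0 <= n)%N -> s n z = w.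
  have [[m em]|none] := pselect (exists m, eta m z != 0).
    by exists (lincomb 1 (c m) nu (eta m) z), m.+1 => n; exact: s_on.
  exists (nu z), 0%N => n _; apply: s_off => i _; apply/eqP.
  by apply: contrapT => /negP ei; apply: none; exists i.
have scvg z : cvgn (fun n => Re (s n z)) /\ cvgn (fun n => Im (s n z)).
  have [w [n0 sw]] := eventually_cst z.
  split; apply/cvg_ex; [exists (Re w)|exists (Im w)]; apply: cvg_near_cst;
    by exists n0 => // n /= /sw ->.
have [nu' [Znu' lim']] := Zclass_limit oS Bmu Zs sk (ae_onT (fun z _ => scvg z)).
exists nu'; split => //.
  apply: ae_onS2 lim' (ae_on_forall sk) => z _ [h1 h2] h3.
  exact: (modulus_limit_le (n0 := 0%N) h1 h2).
move=> m; apply: ae_onS lim' => z _ [h1 h2] em.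
have near (F : plane R -> R) :
    (fun n => F (s n z)) @ \oo --> F (lincomb 1 (c m) nu (eta m) z).
  by apply: cvg_near_cst; exists m.+1 => // n /= mn; rewrite (s_on m).
have e1 : Re (nu' z) = Re (lincomb 1 (c m) nu (eta m) z).
  exact: (cvg_unique _ h1 (near Re)).
have e2 : Im (nu' z) = Im (lincomb 1 (c m) nu (eta m) z).
  exact: (cvg_unique _ h2 (near Im)).
by apply/eqP; rewrite eq_complex; apply/andP; split; apply/eqP.
Qed.

End Superposition.

(** * Infinitely many extremal elements *)

Section Main.
Context {R : realType}.
Local Notation T := (measurableTypeR R * measurableTypeR R)%type.
Variables (S : set (plane R)) (oS : open S) (S0 : S !=set0).
Implicit Types (mu nu : plane R -> plane R).

Definition nonlandslide_extremals mu := [set nu | [/\ extremal S mu nu,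
  ~ landslide S nu & ~ constant_modulus S nu]].

Lemma ess_sup_lt (E : set (plane R)) nu (k : R) : (ess_sup_on E nu < k%:E)%E ->
  exists2 c : R, 0 <= c < k & ae_on E (fun z => modulus (nu z) <= c).
Proof.
have := ess_sup_on_ge0 E nu; case Ec : (ess_sup_on E nu) => [c| |]//.
rewrite lee_fin lte_fin => c0 ck; exists c; rewrite ?c0//.
by apply/ess_sup_on_leP; rewrite ?Ec.
Qed.

Lemma nonconstant_modulus mu nu (c k : R) : Znorm S mu = k%:E ->
  extremal S mu nu -> 0 <= c < k ->
  ~ ae_on S (fun z => c < modulus (nu z)) -> ~ constant_modulus S nu.
Proof.
move=> Zk [_ nuk] /andP[c0 ck] nc [d nud]; apply: nc.
have [dc|cd] := leP d c; last by apply: ae_onS nud => z _ ->.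
have : (ess_sup_on S nu <= c%:E)%E.
  by apply/ess_sup_on_leP => //; apply: ae_onS nud => z _ ->.
by rewrite nuk Zk lee_fin leNgt ck.
Qed.

(** In every box but the first, as much of the annihilator is added as the bound
    [k] allows: this destroys the landslides. In box 0, where [nu] stays below
    [c < k], a small multiple [u j] of the annihilator is added: the modulus
    stays below [k] there, so that it is not constant, and the values on the
    block distinguish the results for different [j]. *)
Lemma infinite_of_landslide mu nu : Bel S mu -> extremal S mu nu -> landslide S nu ->
  infinite_set (ae_class S @` nonlandslide_extremals mu).
Proof.
move=> Bmu Enu [E [oE E0 ES lt]].
have [k k0 Zk] := ZnormP oS Bmu.
have [Znu nuk] := iffLR (extremalP nu k0 Zk) Enu.
move: lt; rewrite Enu.2 Zk => /ess_sup_lt[c /andP[c_ge0 ck] nuc].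
have [V [Vbox V0 VS Vbase]] := exists_boxes oE E0 ES.
have [eta [etaP disj]] := disjoint_annihilators oS Vbox VS.
have [t tP] := choice (fun n => sharp_coefficient (etaP n) (VS n) nuk).
have [M M0 etaM] := annihilator_bound (etaP 0%N).
have [P [mP P0 Peta]] := ann_block (etaP 0%N).
have PV : P `<=` V 0%N.
  by move=> p Pp; apply: (ann_supp (etaP 0%N)); rewrite Peta ?oner_neq0.
have PS : P `<=` toC @^-1` S by move=> p /PV/VS.
(* small enough for the sum to stay below the midpoint of [c] and [k] *)
pose u n := (k - c) / M / 2 / n.+1%:R.
have u_gt0 n : 0 < u n by rewrite !divr_gt0 ?subr_gt0.
have uM n : c + u n * M <= (c + k) / 2.
  have : u n * M <= (k - c) / 2.
    have -> : u n * M = (k - c) / 2 * n.+1%:R^-1.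
      have Mn : M != 0 by rewrite gt_eqF.
      have : n.+1%:R != 0 :> R by rewrite pnatr_eq0.
      by rewrite /u; move: (n.+1%:R) => a an; field; rewrite Mn an.
    by rewrite ler_piMr ?divr_ge0 ?subr_ge0 ?(ltW ck)// invf_le1 ?ler1n.
  lra.
pose m := (c + k) / 2.
have [cm mk] : c < m /\ m < k by rewrite /m; split; lra.
pose coef j n := if n is n'.+1 then t n else u j.
have eta0E j : ae_on S (fun z => eta 0%N z != 0 ->
    modulus (lincomb 1 (u j) nu (eta 0%N) z) <= m).
  have H : ae_on S (fun z => E z -> modulus (nu z) <= c).
    by move: nuc; rewrite /ae_on; apply: filterS => p + _ Ep; apply.
  apply: ae_onS H => z _ h ez.
  have Ez : E z.
    rewrite -(toC_ReIm z); apply: V0; apply: (ann_supp (etaP 0%N)).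
    by rewrite toC_ReIm.
  apply: le_trans (uM j); rewrite (le_trans (modulus_lincomb _ _ _ _ _))//.
  rewrite normr1 mul1r gtr0_norm// lerD ?h// ler_wpM2l//; exact: ltW.
have bound j n : ae_on S (fun z => eta n z != 0 ->
    modulus (lincomb 1 (coef j n) nu (eta n) z) <= k).
  case: n => [|n]; last by case: (tP n.+1).
  by apply: ae_onS (eta0E j) => z _ h /h/le_trans; apply; exact: ltW.
have Beta n : Bel S (eta n) by exact: annihilator_Bel (etaP n).
have orth n phi : Q S phi -> cintegral S (fun z => eta n z * phi z) = 0.
  by move=> [hphi _]; exact: (ann_orth (etaP n)).
have [f fP] := choice (fun j => superposition oS Bmu Znu Beta orth disj nuk (bound j)).
have Ef j : extremal S mu (f j) by apply/(extremalP _ k0 Zk); case: (fP j).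
have f0 j : ae_on S (fun z => eta 0%N z != 0 -> f j z = lincomb 1 (u j) nu (eta 0%N) z).
  by case: (fP j) => _ _ /(_ 0%N).
apply: (infinite_classes (f := f)).
- move=> j; split => //.
  + move=> [U [oU U0 US]]; rewrite (Ef j).2 Zk => /ess_sup_lt[d /andP[_ dk] fd].
    have [n nU] := Vbase U oU U0 US.
    have [_ /(_ d dk)] := tP n.+1; apply.
    have [_ _ /(_ n.+1) fn] := fP j.
    have fd' : ae_on S (fun z => U z -> modulus (f j z) <= d).
      by move: fd; rewrite /ae_on; apply: filterS => p + _ Up; apply.
    apply: ae_onS2 fn fd' => z _ h1 h2 ez; rewrite -h1// h2//.
    rewrite -(toC_ReIm z); apply: nU; apply: (ann_supp (etaP n.+1)).
    by rewrite toC_ReIm.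
  + apply: (nonconstant_modulus (c := m) Zk (Ef j)).
      by rewrite mk andbT (le_trans c_ge0)// ltW.
    move=> big; have both := ae_onS2 (fun z _ h1 h2 => conj h1 h2) (f0 j)
      (ae_onS2 (fun z _ h1 h2 => conj h1 h2) (eta0E j) big).
    have [p Pp [h1 [h2 h3]]] := ae_on_exists mP P0 PS both.
    have ep : eta 0%N (toC p) != 0 by rewrite Peta// oner_neq0.
    by move: h3; rewrite h1// ltNge h2.
- by move=> j; case: (fP j) => -[].
- move=> i j fij.
  have both := ae_onS2 (fun z _ h1 h2 => conj h1 h2) fij
      (ae_onS2 (fun z _ h1 h2 => conj h1 h2) (f0 i) (f0 j)).
  have [p Pp [h1 [h2 h3]]] := ae_on_exists mP P0 PS both.
  have ep : eta 0%N (toC p) != 0 by rewrite Peta// oner_neq0.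
  move: h1; rewrite h2// h3// /lincomb Peta// !mulr1 => /addrI/complexI.
  rewrite /u => /mulfI; rewrite gt_eqF ?divr_gt0 ?subr_gt0// => /(_ isT)/invr_inj/eqP.
  by rewrite eqr_nat => /eqP[].
Qed.

(** The proper convex combinations of two extremal elements. Where these two
    differ, strict convexity keeps the modulus of a combination below the
    norm. *)
Lemma infinite_of_two mu nu nu' : Bel S mu -> extremal S mu nu -> extremal S mu nu' ->
  ~ ae_on S (fun z => nu z = nu' z) ->
  (forall f, extremal S mu f -> ~ landslide S f) ->
  infinite_set (ae_class S @` nonlandslide_extremals mu).
Proof.
move=> Bmu E1 E2 diff nland.
have [k k0 Zk] := ZnormP oS Bmu.
have [Z1 b1] := iffLR (extremalP nu k0 Zk) E1.
have [Z2 b2] := iffLR (extremalP nu' k0 Zk) E2.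
pose t j : R := j.+2%:R^-1.
have t01 j : 0 < t j < 1 by rewrite /t invr_gt0 ltr0n/= invf_lt1 ?ltr1n.
pose f j := lincomb (1 - t j) (t j) nu nu'.
have Ef j : extremal S mu (f j).
  have /andP[t0 t1] := t01 j; have s0 : 0 <= 1 - t j by rewrite subr_ge0 ltW.
  apply/(extremalP _ k0 Zk); split; first by apply: Zclass_lincomb; rewrite // subrK.
  apply: ae_onS2 b1 b2 => z _ h1 h2.
  rewrite (le_trans (modulus_lincomb _ _ _ _ _))// (ger0_norm s0) (gtr0_norm t0).
  have := ler_wpM2l s0 h1; have := ler_wpM2l (ltW t0) h2; lra.
apply: (infinite_classes (f := f)).
- move=> j; split => //; first exact: nland.
  move=> [d fd]; apply: diff.
  have dk : d = k.
    have Pk : ae_on S (fun z => modulus (f j z) <= k).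
      by have [] := iffLR (extremalP _ k0 Zk) (Ef j).
    have S_pos := nonempty_open_area oS S0.
    have [p Sp [h1 h2]] := ae_on_exists (open_measurable oS) S_pos (fun=> id)
      (ae_onS2 (fun z _ h1 h2 => conj h1 h2) fd Pk).
    apply/eqP; rewrite eq_le -{1}h1 h2/= -lee_fin -Zk -(Ef j).2.
    apply/ess_sup_on_leP; first by rewrite -h1 modulus_ge0.
    by apply: ae_onS fd => z _ ->.
  have both := ae_onS2 (fun z _ h1 h2 => conj h1 h2) b1 b2.
  apply: ae_onS2 fd both => z _ h [h1 h2].
  by apply: (disc_strictly_convex (t01 j) h1 h2); rewrite -dk.
- by move=> j; case: (Ef j) => -[].
- move=> i j fij; apply: contrapT => ij; apply: diff.
  apply: ae_onS fij => z _; rewrite /f /lincomb => H.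
  have tij : t i - t j != 0.
    by rewrite subr_eq0; apply/eqP => /invr_inj/eqP; rewrite eqr_nat => /eqP[].
  apply/eqP; rewrite -subr_eq0; apply/eqP.
  have : (t i - t j)%:C * (nu z - nu' z) = 0.
    move: H; case: (nu z) (nu' z) => [x y] [x' y'] /eqP.
    rewrite eq_complex/= => /andP[/eqP H1 /eqP H2].
    by apply/eqP; rewrite eq_complex/=; apply/andP; split; apply/eqP; lra.
  move/eqP; rewrite mulf_eq0 => /orP[|/eqP//].
  by rewrite eq_complex/= eqxx andbT (negbTE tij).
Qed.

End Main.

Theorem theorem1 (R : realType) (S : set (plane R))
    (hS : plane_domain S)
    (hbd : exists a b : plane R, [/\ boundary S a, boundary S b & a <> b])
    (mu : plane R -> plane R) (hmu : Bel S mu) :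
  ~ (exists! c, (ae_class S @` extremal S mu) c) ->
  infinite_set (ae_class S @`
    [set nu | [/\ extremal S mu nu, ~ landslide S nu &
                  ~ constant_modulus S nu]]).
Proof.
move=> nuniq; have [oS _ S0] := hS.
have [[f [Ef lf]]|nland] := pselect (exists f, extremal S mu f /\ landslide S f).
  exact: infinite_of_landslide hmu Ef lf.
have [nu Enu] := exists_extremal oS hmu.
have [nu' [Enu' diff]] :
    exists nu', extremal S mu nu' /\ ~ ae_on S (fun z => nu z = nu' z).
  apply: contrapT => all_eq; apply: nuniq; exists (ae_class S nu).
  split; first by exists nu.
  move=> _ [nu' Enu' <-]; have same : ae_on S (fun z => nu z = nu' z).
    by apply: contrapT => diff; apply: all_eq; exists nu'.
  apply/seteqP; split => h [Bh hnu]; split => //.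
    by apply: ae_onS2 hnu same => z _ -> ->.
  by apply: ae_onS2 hnu same => z _ -> ->.
apply: (infinite_of_two oS S0 hmu Enu Enu' diff) => f Ef lf.
by apply: nland; exists f.
Qed.
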